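(* Let $X\neq\{0\}$ be an order continuous, locally c-convex Banach sequence space. Then the unit sphere $S_X$ is the Shilov boundary for both $\mathcal{A}_u(B_X)$ and $\mathcal{A}_b(B_X)$.
   Context: For a complex Banach space $X$, $B_X$ is the closed unit ball and $S_X$ the unit sphere. $\mathcal{A}_b(B_X)$ is the Banach algebra (sup norm) of all bounded continuous functions $f:B_X\to\mathbb{C}$ that are holomorphic on the interior of $B_X$; $\mathcal{A}_u(B_X)$ is the subalgebra of those $f\in\mathcal{A}_b(B_X)$ that are uniformly continuous on $B_X$. A set $F\subset B_X$ is a boundary for an algebra $\mathcal{A}$ of bounded continuous functions on $B_X$ if $\|f\|=\sup_{x\in F}|f(x)|$ for all $f\in\mathcal{A}$ (where $\|f\|=\sup_{x\in B_X}|f(x)|$). If the intersection of all closed boundaries for $\mathcal{A}$ is again a boundary for $\mathcal{A}$, it is called the Shilov boundary for $\mathcal{A}$. A point $x\in B_X$ is a complex extreme point of $B_X$ if for every nonzero $y\in X$ there is $\zeta\in\mathbb{C}$ with $|\zeta|\le1$ and $x+\zeta y\notin B_X$. $X$ is strictly c-convex if every point of $S_X$ is a complex extreme point of $B_X$. For $x\in B_X$ the face at $x$ is $\mathcal{F}(x)=\{x+y: y\in X,\ \sup_{|\zeta|\le1}\|x+\zeta y\|\le1\}$ ($\zeta\in\mathbb{C}$). A point $x\in S_X$ has a strong face if for each $\epsilon>0$ there is $\delta(\epsilon)>0$ such that every $y\in X$ with $\mathrm{dist}(\mathcal{F}(x),y)\ge\epsilon$ satisfies $\sup_{0\le\theta\le2\pi}\|x+e^{i\theta}(x-y)\|\ge1+\delta(\epsilon)$.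 $X$ is locally c-convex if it is strictly c-convex and every point of $S_X$ has a strong face. A sequence $x=\{x(k)\}$ is positive if $x(k)\ge0$ for all $k\in\mathbb{N}$; $x\ge y$ means $x-y$ is positive; $|x|=\{|x(k)|\}$. A Banach sequence space $(X,\|\cdot\|)$ is a Banach space of complex sequences such that if $x$ is a sequence with $|x|\le|y|$ for some $y\in X$, then $x\in X$ and $\|x\|\le\|y\|$. It is order continuous if every sequence $\{x_n\}$ in $X$ with $0\le x_1\le x_2\le\cdots\le y$ for some positive $y\in X$ is norm-convergent. *)

(* Defs.v *)
From Stdlib Require Import Reals.
From Coquelicot Require Import Coquelicot.

Set Implicit Arguments.
Open Scope R_scope.

Definition cexpi (t : R) : C := (cos t, sin t).

Section ComplexNormedSpace.

Variable X : NormedModule C_AbsRing.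

Definition unit_ball (x : X) : Prop := norm x <= 1.
Definition unit_sphere (x : X) : Prop := norm x = 1.

(* The supremum is taken in [Rbar]: it is [m_infty] when [F] is empty. *)
Definition sup_mod (F : X -> Prop) (f : X -> C) : Rbar :=
  Lub_Rbar (fun r => exists x, F x /\ r = Cmod (f x)).

(* Functions on the ball are represented by total functions on [X] whose values
   off the ball are irrelevant: every condition below looks at the ball only. *)
Definition algebra_b (f : X -> C) : Prop :=
  (exists M, forall x, unit_ball x -> Cmod (f x) <= M) /\
  continuous_on (U := C_UniformSpace) unit_ball f /\
  (* complex Frechet differentiability, since the scalars are [C_AbsRing],
     at the interior points of the ball *)
  (forall x, locally x unit_ball ->
     ex_filterdiff (V := C_NormedModule) f (locally x)).

Definition algebra_u (f : X -> C) : Prop :=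
  algebra_b f /\
  forall eps, 0 < eps -> exists delta, 0 < delta /\
    forall x y, unit_ball x -> unit_ball y ->
      norm (minus x y) < delta -> Cmod (f x - f y) < eps.

Definition boundary (A : (X -> C) -> Prop) (F : X -> Prop) : Prop :=
  (forall x, F x -> unit_ball x) /\
  forall f, A f -> sup_mod unit_ball f = sup_mod F f.

Definition closed_boundaries_inter (A : (X -> C) -> Prop) (x : X) : Prop :=
  forall F : X -> Prop, closed F -> boundary A F -> F x.

Definition is_shilov_boundary (A : (X -> C) -> Prop) (S : X -> Prop) : Prop :=
  boundary A (closed_boundaries_inter A) /\
  forall x, S x <-> closed_boundaries_inter A x.

Definition complex_extreme (x : X) : Prop :=
  unit_ball x /\
  forall y, y <> zero ->
    exists zeta : C, Cmod zeta <= 1 /\ ~ unit_ball (plus x (scal zeta y)).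

Definition strictly_c_convex : Prop :=
  forall x, unit_sphere x -> complex_extreme x.

Definition face (x z : X) : Prop :=
  exists y, z = plus x y /\
    Rbar_le
      (Lub_Rbar (fun r => exists zeta : C,
         Cmod zeta <= 1 /\ r = norm (plus x (scal zeta y))))
      1.

Definition dist_to (F : X -> Prop) (y : X) : Rbar :=
  Glb_Rbar (fun r => exists z, F z /\ r = norm (minus z y)).

Definition has_strong_face (x : X) : Prop :=
  forall eps : R, 0 < eps -> exists delta : R, 0 < delta /\
    forall y, Rbar_le eps (dist_to (face x) y) ->
      Rbar_le (1 + delta)
        (Lub_Rbar (fun r => exists theta,
           0 <= theta <= 2 * PI /\
           r = norm (plus x (scal (cexpi theta) (minus x y))))).

Definition locally_c_convex : Prop :=
  strictly_c_convex /\ forall x, unit_sphere x -> has_strong_face x.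

End ComplexNormedSpace.

Arguments is_shilov_boundary {X} A S.
Arguments algebra_b X f : clear implicits.
Arguments algebra_u X f : clear implicits.
Arguments unit_sphere X x : clear implicits.

(* A Banach space of sequences is a complete normed module [X] together with
   the injective linear map [coord] sending a vector to its sequence of terms;
   "the sequence [s] belongs to [X]" reads [exists x, coord x = s] pointwise. *)
Record banach_sequence_space
    (X : CompleteNormedModule C_AbsRing) (coord : X -> nat -> C) : Prop := {
  coord_plus : forall x y k, coord (plus x y) k = (coord x k + coord y k)%C;
  coord_scal : forall (a : C) x k, coord (scal a x) k = (a * coord x k)%C;
  coord_inj : forall x y, (forall k, coord x k = coord y k) -> x = y;
  coord_solid : forall (s : nat -> C) (y : X),
    (forall k, Cmod (s k) <= Cmod (coord y k)) ->
    exists x, (forall k, coord x k = s k) /\ norm x <= norm y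
}.

Definition seq_positive (s : nat -> C) : Prop :=
  forall k, 0 <= Re (s k) /\ Im (s k) = 0.

Definition order_continuous
    (X : CompleteNormedModule C_AbsRing) (coord : X -> nat -> C) : Prop :=
  forall (x : nat -> X) (y : X),
    seq_positive (coord y) ->
    seq_positive (coord (x 0%nat)) ->
    (forall n, seq_positive (coord (minus (x (S n)) (x n)))) ->
    (forall n, seq_positive (coord (minus y (x n)))) ->
    exists l : X, filterlim x eventually (locally l).

(* Main.v *)
(** Maximum modulus: along a complex line through a point of the ball, a Moebius
    change of variable reduces [|f| <= sup over the sphere] to the mean value property
    at the centre of a disc.  The latter is Goursat's theorem for [f o exp] on a
    rectangle of height [2 PI]; derivatives need not be continuous, so Goursat's
    bisection is really used.

    Peak functions: order continuity makes finitely supported vectors dense in the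
    sphere.  Let [p] be one of them and [b_j] the values on [p_j e_j] of a functional
    norming [p].  Then [sum b_j |z_j / p_j| <= |z| <= 1 = sum b_j], strict c-convexity
    makes the [b_j] positive, and with [t_j = b_j (z_j / p_j - 1)] one gets
    [Re (sum (t_j^2 / 4 - t_j)) >= sum |t_j|^2 / 4] on the ball.  Hence
    [1 / (1 + sum (t_j^2 / 4 - t_j))] has modulus at most 1, with equality only if all
    [t_j] vanish.  If the [t_j] are small then [z] is close to [p] on the support of [p];
    the rest [y] of [z] is disjoint from [p], so [p + zeta y] has norm close to at most 1
    for [|zeta| <= 1], and since the face of [p] is [{p}], the strong face property
    makes [y] small. *)

Require Import Defs.
From Stdlib Require Import Reals.
From Coquelicot Require Import Coquelicot.
From Stdlib Require Import Lra Lia Classical.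
Open Scope R_scope.

(** * Goursat's theorem on rectangles *)

(** For [F = U + iV] this concerns the 1-form [V dx + U dy = Im (F dz)]: its coefficients are
    differentiable at the point, and the shared [al] expresses [U_x = V_y], that is, closedness. *)
Definition closed_form_at (U V : R -> R -> R) (x0 y0 : R) : Prop :=
  exists al be ga, forall eps, 0 < eps -> exists delta, 0 < delta /\
    forall x y, Rabs (x - x0) < delta -> Rabs (y - y0) < delta ->
      Rabs (U x y - U x0 y0 - (al * (x - x0) + be * (y - y0)))
        <= eps * (Rabs (x - x0) + Rabs (y - y0)) /\
      Rabs (V x y - V x0 y0 - (ga * (x - x0) + al * (y - y0)))
        <= eps * (Rabs (x - x0) + Rabs (y - y0)).

(** The counterclockwise integral of [V dx + U dy] around [[a,b] x [c,d]]. *)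
Definition circulation (U V : R -> R -> R) (a b c d : R) : R :=
  (RInt (fun x => V x c) a b - RInt (fun x => V x d) a b)
  + (RInt (fun y => U b y) c d - RInt (fun y => U a y) c d).

Lemma affine_approx_continuous (f : R -> R) (x0 k : R) :
  (exists delta, 0 < delta /\ forall x, Rabs (x - x0) < delta ->
     Rabs (f x - f x0 - k * (x - x0)) <= Rabs (x - x0)) ->
  continuous f x0.
Proof.
  intros [d [Hd H]].
  apply continuity_pt_filterlim, continuity_pt_locally; intros eps.
  assert (Hk : 0 < Rabs k + 1) by (pose proof (Rabs_pos k); lra).
  assert (He : 0 < eps / (Rabs k + 1)) by (apply Rdiv_lt_0_compat; [apply cond_pos | lra]).
  assert (Hm : 0 < Rmin d (eps / (Rabs k + 1))) by (apply Rmin_pos; lra).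
  exists (mkposreal _ Hm); intros y Hy.
  change (Rabs (y - x0) < Rmin d (eps / (Rabs k + 1))) in Hy.
  specialize (H y (Rlt_le_trans _ _ _ Hy (Rmin_l _ _))).
  apply (fun h => Rlt_le_trans _ _ _ h (Rmin_r _ _)) in Hy.
  apply (Rmult_lt_compat_r (Rabs k + 1)) in Hy; [|lra].
  replace (eps / (Rabs k + 1) * (Rabs k + 1)) with (pos eps) in Hy by (field; lra).
  pose proof (Rabs_triang (f y - f x0 - k * (y - x0)) (k * (y - x0))) as T.
  replace (f y - f x0 - k * (y - x0) + k * (y - x0)) with (f y - f x0) in T by ring.
  rewrite Rabs_mult in T; lra.
Qed.

Lemma closed_form_continuous_x U V x0 y0 :
  closed_form_at U V x0 y0 -> continuous (fun x => V x y0) x0.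
Proof.
  intros (al & be & ga & H); destruct (H 1 Rlt_0_1) as [d [Hd K]].
  apply affine_approx_continuous with ga; exists d; split; [exact Hd|]; intros x Hx.
  destruct (K x y0 Hx) as [_ K2].
  { rewrite Rminus_diag, Rabs_R0; exact Hd. }
  rewrite Rminus_diag, Rabs_R0, Rmult_0_r, !Rplus_0_r in K2; lra.
Qed.

Lemma closed_form_continuous_y U V x0 y0 :
  closed_form_at U V x0 y0 -> continuous (fun y => U x0 y) y0.
Proof.
  intros (al & be & ga & H); destruct (H 1 Rlt_0_1) as [d [Hd K]].
  apply affine_approx_continuous with be; exists d; split; [exact Hd|]; intros y Hy.
  destruct (fun h => K x0 y h Hy) as [K1 _].
  { rewrite Rminus_diag, Rabs_R0; exact Hd. }
  rewrite Rminus_diag, Rabs_R0, Rmult_0_r, !Rplus_0_l in K1; lra.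
Qed.

Section Rectangle.

Variables (U V : R -> R -> R) (A B C D : R).
Hypothesis form_closed : forall x y, A <= x <= B -> C <= y <= D -> closed_form_at U V x y.

Lemma ex_RInt_V y a b :
  C <= y <= D -> A <= a -> a <= b -> b <= B -> ex_RInt (fun x => V x y) a b.
Proof.
  intros Hy Ha Hab Hb; apply (ex_RInt_continuous (V := R_CompleteNormedModule)).
  rewrite Rmin_left, Rmax_right by lra; intros x Hx.
  apply closed_form_continuous_x with U, form_closed; lra.
Qed.

Lemma ex_RInt_U x c d :
  A <= x <= B -> C <= c -> c <= d -> d <= D -> ex_RInt (fun y => U x y) c d.
Proof.
  intros Hx Hc Hcd Hd; apply (ex_RInt_continuous (V := R_CompleteNormedModule)).
  rewrite Rmin_left, Rmax_right by lra; intros y Hy.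
  apply closed_form_continuous_y with V, form_closed; lra.
Qed.

(** The two passages along the common edge [x = m] have opposite directions and cancel. *)
Lemma circulation_split_x a m b c d :
  A <= a -> a <= m -> m <= b -> b <= B -> C <= c -> c <= d -> d <= D ->
  circulation U V a b c d = circulation U V a m c d + circulation U V m b c d.
Proof.
  intros; unfold circulation.
  rewrite <- (RInt_Chasles (fun x => V x c) a m b) by (apply ex_RInt_V; lra).
  rewrite <- (RInt_Chasles (fun x => V x d) a m b) by (apply ex_RInt_V; lra).
  unfold plus; simpl; ring.
Qed.

Lemma circulation_split_y a b c m d :
  A <= a -> a <= b -> b <= B -> C <= c -> c <= m -> m <= d -> d <= D ->
  circulation U V a b c d = circulation U V a b c m + circulation U V a b m d.
Proof.
  intros; unfold circulation.
  rewrite <- (RInt_Chasles (fun y => U b y) c m d) by (apply ex_RInt_U; lra).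
  rewrite <- (RInt_Chasles (fun y => U a y) c m d) by (apply ex_RInt_U; lra).
  unfold plus; simpl; ring.
Qed.

Lemma ex_RInt_Rminus (f g : R -> R) a b :
  ex_RInt f a b -> ex_RInt g a b -> ex_RInt (fun x => f x - g x) a b.
Proof. exact (@ex_RInt_minus R_NormedModule f g a b). Qed.

Lemma RInt_Rminus (f g : R -> R) a b :
  ex_RInt f a b -> ex_RInt g a b ->
  RInt (fun x => f x - g x) a b = RInt f a b - RInt g a b.
Proof. exact (@RInt_minus R_CompleteNormedModule f g a b). Qed.

Lemma RInt_near_const (f : R -> R) a b k e :
  a <= b -> ex_RInt f a b -> (forall t, a <= t <= b -> Rabs (f t - k) <= e) ->
  Rabs (RInt f a b - k * (b - a)) <= e * (b - a).
Proof.
  intros Hab Hf H.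
  replace (RInt f a b - k * (b - a)) with (RInt (fun t => f t - k) a b).
  - rewrite (Rmult_comm e); apply abs_RInt_le_const; auto.
    apply ex_RInt_Rminus; [exact Hf | apply ex_RInt_const].
  - rewrite RInt_Rminus; [|exact Hf|apply ex_RInt_const].
    rewrite RInt_const; unfold scal; simpl; unfold mult; simpl; ring.
Qed.

(* On a small rectangle only the constants [al * (c - d)] and [al * (b - a)] of the
   two differences survive, and they cancel because the form is closed. *)
Lemma circulation_bound a b c d x0 y0 al be ga e :
  A <= a -> a <= b -> b <= B -> C <= c -> c <= d -> d <= D ->
  (forall x y, a <= x <= b -> c <= y <= d ->
     Rabs (U x y - U x0 y0 - (al * (x - x0) + be * (y - y0))) <= e /\
     Rabs (V x y - V x0 y0 - (ga * (x - x0) + al * (y - y0))) <= e) ->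
  Rabs (circulation U V a b c d) <= 2 * e * ((b - a) + (d - c)).
Proof.
  intros Ha Hab Hb Hc Hcd Hd H; unfold circulation.
  rewrite <- (RInt_Rminus (fun x => V x c) (fun x => V x d)) by (apply ex_RInt_V; lra).
  rewrite <- (RInt_Rminus (fun y => U b y) (fun y => U a y)) by (apply ex_RInt_U; lra).
  assert (I1 : Rabs (RInt (fun x => V x c - V x d) a b - al * (c - d) * (b - a))
               <= 2 * e * (b - a)).
  { apply RInt_near_const; [lra| |].
    - apply ex_RInt_Rminus; apply ex_RInt_V; lra.
    - intros t Ht; destruct (H t c Ht) as [_ K1]; [lra|].
      destruct (H t d Ht) as [_ K2]; [lra|].
      apply Rabs_le; apply Rabs_le_between in K1, K2; lra. }
  assert (I2 : Rabs (RInt (fun y => U b y - U a y) c d - al * (b - a) * (d - c))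
               <= 2 * e * (d - c)).
  { apply RInt_near_const; [lra| |].
    - apply ex_RInt_Rminus; apply ex_RInt_U; lra.
    - intros t Ht; destruct (H b t) as [K1 _]; [lra|lra|].
      destruct (H a t) as [K2 _]; [lra|lra|].
      apply Rabs_le; apply Rabs_le_between in K1, K2; lra. }
  apply Rabs_le; apply Rabs_le_between in I1, I2; lra.
Qed.

(** By additivity one of the halves carries at least half of the circulation in absolute value; if
    the test fails for the left one, the right one does. *)
Definition halve_x (r : (R * R) * (R * R)) :=
  let '((a, b), (c, d)) := r in
  let m := (a + b) / 2 in
  if Rle_dec (Rabs (circulation U V a b c d)) (2 * Rabs (circulation U V a m c d))
  then ((a, m), (c, d)) else ((m, b), (c, d)).

Definition halve_y (r : (R * R) * (R * R)) :=
  let '((a, b), (c, d)) := r in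
  let m := (c + d) / 2 in
  if Rle_dec (Rabs (circulation U V a b c d)) (2 * Rabs (circulation U V a b c m))
  then ((a, b), (c, m)) else ((a, b), (m, d)).

Fixpoint bisection (n : nat) : (R * R) * (R * R) :=
  match n with
  | O => ((A, B), (C, D))
  | S n => halve_y (halve_x (bisection n))
  end.

Definition left_end n := fst (fst (bisection n)).
Definition right_end n := snd (fst (bisection n)).
Definition low_end n := fst (snd (bisection n)).
Definition high_end n := snd (snd (bisection n)).

Hypotheses (HAB : A <= B) (HCD : C <= D).

(** Each halving loses at most a factor 2 of the circulation and a step makes two of them, hence
    [4 ^ n]. The monotonicity of the endpoints serves [nested_point]. *)
Lemma bisection_spec n :
  (A <= left_end n /\ left_end n <= right_end n /\ right_end n <= B) /\
  (C <= low_end n /\ low_end n <= high_end n /\ high_end n <= D) /\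
  right_end n - left_end n = (B - A) / 2 ^ n /\
  high_end n - low_end n = (D - C) / 2 ^ n /\
  Rabs (circulation U V A B C D)
    <= 4 ^ n * Rabs (circulation U V (left_end n) (right_end n) (low_end n) (high_end n)) /\
  left_end n <= left_end (S n) /\ right_end (S n) <= right_end n /\
  low_end n <= low_end (S n) /\ high_end (S n) <= high_end n.
Proof.
  unfold left_end, right_end, low_end, high_end.
  (* Stated for an arbitrary rectangle because the claim at [S n] also involves the next step, to
     [S (S n)]. *)
  assert (step : forall r : (R * R) * (R * R),
    A <= fst (fst r) -> fst (fst r) <= snd (fst r) -> snd (fst r) <= B ->
    C <= fst (snd r) -> fst (snd r) <= snd (snd r) -> snd (snd r) <= D ->
    let r' := halve_y (halve_x r) in
    fst (fst r) <= fst (fst r') /\ snd (fst r') <= snd (fst r) /\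
    fst (snd r) <= fst (snd r') /\ snd (snd r') <= snd (snd r) /\
    snd (fst r') - fst (fst r') = (snd (fst r) - fst (fst r)) / 2 /\
    snd (snd r') - fst (snd r') = (snd (snd r) - fst (snd r)) / 2 /\
    Rabs (circulation U V (fst (fst r)) (snd (fst r)) (fst (snd r)) (snd (snd r))) <=
    4 * Rabs (circulation U V (fst (fst r')) (snd (fst r')) (fst (snd r')) (snd (snd r')))).
  { intros [[a b] [c d]]; simpl; intros.
    assert (Ex := circulation_split_x a ((a + b) / 2) b c d).
    assert (Ey := fun a b => circulation_split_y a b c ((c + d) / 2) d).
    destruct (Rle_dec (Rabs (circulation U V a b c d))
                      (2 * Rabs (circulation U V a ((a + b) / 2) c d))) as [E1|E1]; simpl.
    - specialize (Ey a ((a + b) / 2)).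
      destruct (Rle_dec (Rabs (circulation U V a ((a + b) / 2) c d)) _) as [E2|E2]; simpl;
        repeat split; try lra.
      rewrite Ey in E1, E2 by lra.
      pose proof (Rabs_triang (circulation U V a ((a + b) / 2) c ((c + d) / 2))
                              (circulation U V a ((a + b) / 2) ((c + d) / 2) d)); lra.
    - specialize (Ey ((a + b) / 2) b).
      rewrite Ex in E1 |- * by lra.
      pose proof (Rabs_triang (circulation U V a ((a + b) / 2) c d)
                              (circulation U V ((a + b) / 2) b c d)).
      destruct (Rle_dec (Rabs (circulation U V ((a + b) / 2) b c d)) _) as [E2|E2]; simpl;
        repeat split; try lra.
      rewrite Ey in * by lra.
      pose proof (Rabs_triang (circulation U V ((a + b) / 2) b c ((c + d) / 2))
                              (circulation U V ((a + b) / 2) b ((c + d) / 2) d)); lra. }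
  induction n as [|n IH].
  - destruct (step (bisection 0)) as (S1 & S2 & S3 & S4 & _); try (simpl; lra).
    change (halve_y (halve_x (bisection 0))) with (bisection 1) in *.
    change (bisection 0) with ((A, B), (C, D)) in *; cbn [fst snd] in *.
    rewrite !pow_O; repeat split; lra.
  - destruct IH as ((I1 & I2 & I3) & (I4 & I5 & I6) & I7 & I8 & I9 & _).
    pose proof (step (bisection n) I1 I2 I3 I4 I5 I6) as (S1 & S2 & S3 & S4 & S5 & S6 & S7).
    change (halve_y (halve_x (bisection n))) with (bisection (S n)) in *.
    assert (A <= fst (fst (bisection (S n)))) by lra.
    assert (fst (fst (bisection (S n))) <= snd (fst (bisection (S n)))) by lra.
    assert (snd (fst (bisection (S n))) <= B) by lra.
    assert (C <= fst (snd (bisection (S n)))) by lra.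
    assert (fst (snd (bisection (S n))) <= snd (snd (bisection (S n)))) by lra.
    assert (snd (snd (bisection (S n))) <= D) by lra.
    destruct (step (bisection (S n))) as (T1 & T2 & T3 & T4 & _); auto.
    assert (P2 : 0 < 2 ^ n) by (apply pow_lt; lra).
    assert (P4 : 0 < 4 ^ n) by (apply pow_lt; lra).
    split; [auto|]; split; [auto|].
    split; [rewrite S5, I7; simpl; field; lra|].
    split; [rewrite S6, I8; simpl; field; lra|].
    split; [|auto].
    eapply Rle_trans; [exact I9|]; simpl pow.
    rewrite (Rmult_comm 4), Rmult_assoc; apply Rmult_le_compat_l; [lra|exact S7].
Qed.

Lemma nested_point (u v : nat -> R) :
  (forall n, u n <= u (S n)) -> (forall n, v (S n) <= v n) -> (forall n, u n <= v n) ->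
  exists x, forall n, u n <= x <= v n.
Proof.
  intros Hu Hv Huv.
  assert (Mu : forall n m, (n <= m)%nat -> u n <= u m).
  { intros n m Hnm; induction Hnm; [lra|]; specialize (Hu m); lra. }
  assert (Mv : forall n m, (n <= m)%nat -> v m <= v n).
  { intros n m Hnm; induction Hnm; [lra|]; specialize (Hv m); lra. }
  assert (Muv : forall n m, u n <= v m).
  { intros n m; specialize (Mu n (max n m) (Nat.le_max_l _ _)).
    specialize (Mv m (max n m) (Nat.le_max_r _ _)); specialize (Huv (max n m)); lra. }
  destruct (completeness (fun r => exists n, r = u n)) as [x [Hx1 Hx2]].
  - exists (v O); intros r [n ->]; auto.
  - exists (u O), O; reflexivity.
  - exists x; intros n; split; [apply Hx1; exists n; reflexivity|].
    apply Hx2; intros r [m ->]; auto.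
Qed.

(** The bound on the rectangle of index [n] is quadratic in its size [L / 2 ^ n], one factor from
    the length of the sides and one from the error of the linear approximation. So the factor
    [4 ^ n] cancels and [2 * eps * L ^ 2] remains. *)
Lemma goursat : circulation U V A B C D = 0.
Proof.
  destruct (nested_point left_end right_end) as [x0 Hx0];
    try (intros n; apply (bisection_spec n)).
  destruct (nested_point low_end high_end) as [y0 Hy0];
    try (intros n; apply (bisection_spec n)).
  destruct (form_closed x0 y0) as (al & be & ga & H).
  { exact (Hx0 O). } { exact (Hy0 O). }
  set (L := (B - A) + (D - C)).
  assert (HL : 0 <= L) by (unfold L; lra).
  assert (small : forall eps, 0 < eps -> Rabs (circulation U V A B C D) <= 2 * eps * L ^ 2).
  { intros eps Heps; destruct (H eps Heps) as [del [Hdel K]].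
    assert (exists n, L / 2 ^ n < del) as [n Hn].
    (* [L + 1] in place of [L] avoids a division by zero when the rectangle is a point. *)
    { destruct (pow_lt_1_zero (/ 2) (ltac:(rewrite Rabs_pos_eq; lra)) (del / (L + 1)))
        as [n Hn].
      { apply Rdiv_lt_0_compat; lra. }
      exists n; specialize (Hn n (le_n n)).
      rewrite Rabs_pos_eq in Hn by (apply pow_le; lra).
      rewrite pow_inv in Hn.
      assert (P2 : 0 < / 2 ^ n) by (apply Rinv_0_lt_compat, pow_lt; lra).
      apply (Rmult_lt_compat_r (L + 1)) in Hn; [|lra].
      replace (del / (L + 1) * (L + 1)) with del in Hn by (field; lra).
      unfold Rdiv; lra. }
    destruct (bisection_spec n) as ((I1 & I2 & I3) & (I4 & I5 & I6) & I7 & I8 & I9 & _).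
    specialize (Hx0 n); specialize (Hy0 n).
    assert (P2 : 0 < 2 ^ n) by (apply pow_lt; lra).
    set (l := L / 2 ^ n) in *.
    assert (Hl : (right_end n - left_end n) + (high_end n - low_end n) = l).
    { rewrite I7, I8; unfold l, L; field; lra. }
    assert (Bd : Rabs (circulation U V (left_end n) (right_end n) (low_end n) (high_end n))
                 <= 2 * (eps * l) * l).
    { rewrite <- Hl at 2; apply circulation_bound with x0 y0 al be ga; try lra.
      intros x y Hx Hy.
      assert (X1 : Rabs (x - x0) <= right_end n - left_end n) by (apply Rabs_le; lra).
      assert (Y1 : Rabs (y - y0) <= high_end n - low_end n) by (apply Rabs_le; lra).
      destruct (K x y) as [K1 K2]; [lra|lra|].
      assert (eps * (Rabs (x - x0) + Rabs (y - y0)) <= eps * l)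
        by (apply Rmult_le_compat_l; lra).
      split; lra. }
    eapply Rle_trans; [exact I9|].
    apply Rle_trans with (4 ^ n * (2 * (eps * l) * l)).
    { apply Rmult_le_compat_l; [apply pow_le; lra | exact Bd]. }
    right; unfold l; replace 4 with (2 * 2) by ring; rewrite Rpow_mult_distr.
    field; lra. }
  destruct (Req_dec (circulation U V A B C D) 0) as [E|E]; [exact E|exfalso].
  apply Rabs_pos_lt in E.
  (* This [eps] makes the bound smaller than half of the circulation itself. *)
  specialize (small (Rabs (circulation U V A B C D) / (4 * (L ^ 2 + 1)))).
  assert (P : 0 <= L ^ 2) by apply pow2_ge_0.
  assert (Q : 0 < Rabs (circulation U V A B C D) / (4 * (L ^ 2 + 1))).
  { apply Rdiv_lt_0_compat; lra. }
  specialize (small Q).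
  assert (E2 : Rabs (circulation U V A B C D)
    = 4 * (Rabs (circulation U V A B C D) / (4 * (L ^ 2 + 1))) * (L ^ 2 + 1)) by (field; lra).
  nra.
Qed.

End Rectangle.

(** * The maximum modulus principle on the disc *)

Lemma Cmod_le_Re_Im z : Cmod z <= Rabs (Re z) + Rabs (Im z).
Proof.
  unfold Cmod, Re, Im; rewrite <- sqrt_Rsqr_abs, <- sqrt_Rsqr_abs.
  apply Rsqr_incr_0_var.
  - rewrite Rsqr_sqrt by nra.
    pose proof (sqrt_pos (fst z)²) as P1; pose proof (sqrt_pos (snd z)²) as P2.
    rewrite Rsqr_plus, !Rsqr_sqrt by apply Rle_0_sqr; unfold Rsqr in *; nra.
  - apply Rplus_le_le_0_compat; apply sqrt_pos.
Qed.

Lemma Im_le_Cmod z : Rabs (Im z) <= Cmod z.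
Proof. eapply Rle_trans; [apply Rmax_r | apply Rmax_Cmod]. Qed.

(* [C] carries two normed module structures over itself that do not unify: this one, the
   codomain of [is_derive] and [filterdiff_mult_fct], and [C_NormedModule]. *)
Notation CK := (AbsRing_NormedModule C_AbsRing).

Lemma is_derive_C_intro (f : C -> C) (z l : C) :
  (forall eps, 0 < eps -> exists delta, 0 < delta /\ forall w, Cmod (w - z) < delta ->
     Cmod (f w - f z - l * (w - z)) <= eps * Cmod (w - z)) ->
  is_derive (K := C_AbsRing) (V := CK) f z l.
Proof.
  intros H; split; [apply (is_linear_scal_l (K := C_AbsRing) (V := CK))|].
  intros x Hx; apply (@is_filter_lim_locally_unique C_AbsRing CK) in Hx; subst x.
  intros eps; destruct (H eps (cond_pos eps)) as [d [Hd K]].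
  exists (mkposreal d Hd); intros w Hw; specialize (K w Hw).
  change (Cmod (f w - f z - (w - z) * l) <= eps * Cmod (w - z)).
  rewrite (Cmult_comm (w - z)); exact K.
Qed.

Lemma is_derive_C_elim (f : C -> C) (z l : C) :
  is_derive (K := C_AbsRing) (V := CK) f z l ->
  forall eps, 0 < eps -> exists delta, 0 < delta /\ forall w, Cmod (w - z) < delta ->
     Cmod (f w - f z - l * (w - z)) <= eps * Cmod (w - z).
Proof.
  intros [_ H] eps Heps.
  destruct (H z (fun P HP => HP) (mkposreal eps Heps)) as [d K].
  exists d; split; [apply cond_pos|]; intros w Hw; specialize (K w Hw).
  change (Cmod (f w - f z - (w - z) * l) <= eps * Cmod (w - z)) in K.
  rewrite (Cmult_comm l); exact K.
Qed.

(** * The complex exponential and the inverse: derivatives *)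

Definition cexp (z : C) : C := (exp (Re z) * cos (Im z), exp (Re z) * sin (Im z)).

Lemma cexp_plus z w : cexp (z + w) = (cexp z * cexp w)%C.
Proof.
  destruct z as [a b], w as [c d]; unfold cexp; simpl.
  rewrite exp_plus, cos_plus, sin_plus.
  apply injective_projections; simpl; ring.
Qed.

Lemma Cmod_cexp z : Cmod (cexp z) = exp (Re z).
Proof.
  unfold Cmod, cexp; simpl.
  replace (_ + _) with ((exp (Re z))²).
  - rewrite sqrt_Rsqr; [reflexivity | apply Rlt_le, exp_pos].
  - pose proof (sin2_cos2 (Im z)) as E; unfold Rsqr in *; nra.
Qed.

Lemma cexp_near_0 eps : 0 < eps -> exists delta, 0 < delta /\
  forall h, Cmod h < delta -> Cmod (cexp h - 1 - h) <= eps * Cmod h.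
Proof.
  (* The errors collected at the end total at most [6 * eta * Cmod h]; the cap 1 gives
     [exp x <= 2]. *)
  intros Heps; set (eta := Rmin 1 (eps / 8)).
  assert (Heta : 0 < eta) by (apply Rmin_pos; lra).
  assert (eta <= 1) by apply Rmin_l.
  assert (eta <= eps / 8) by apply Rmin_r.
  assert (E : forall f l, f 0 = l -> forall k, derivable_pt_lim f 0 k ->
    exists d : posreal, forall t, Rabs t < d -> Rabs (f t - l - k * t) <= eta * Rabs t).
  { intros f l Hl k Hk; destruct (Hk eta Heta) as [d Hd]; exists d; intros t Ht.
    destruct (Req_dec t 0) as [->|Ht0].
    - rewrite Hl, Rmult_0_r, Rabs_R0, Rminus_diag, Rminus_0_r, Rabs_R0; lra.
    - specialize (Hd t Ht0 Ht); rewrite Rplus_0_l, Hl in Hd.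
      replace (f t - l - k * t) with (((f t - l) / t - k) * t) by (field; auto).
      rewrite Rabs_mult; apply Rmult_le_compat_r; [apply Rabs_pos | lra]. }
  destruct (E exp 1 exp_0 1 derivable_pt_lim_exp_0) as [d1 E1].
  destruct (E cos 1 cos_0 0 derivable_pt_lim_cos_0) as [d2 E2].
  destruct (E sin 0 sin_0 1 derivable_pt_lim_sin_0) as [d3 E3].
  set (d := Rmin (eta / 2) (Rmin d1 (Rmin d2 d3))).
  exists d; split.
  { unfold d; repeat apply Rmin_pos; try apply cond_pos; lra. }
  intros h Hh.
  assert (d <= eta / 2) by apply Rmin_l.
  assert (D : d <= d1 /\ d <= d2 /\ d <= d3).
  { unfold d; repeat split; eapply Rle_trans; try apply Rmin_r.
    - apply Rmin_l.
    - eapply Rle_trans; [apply Rmin_r | apply Rmin_l].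
    - eapply Rle_trans; [apply Rmin_r | apply Rmin_r]. }
  pose proof (re_le_Cmod h) as Hx; pose proof (Im_le_Cmod h) as Hy.
  destruct h as [x y]; simpl in Hx, Hy; set (m := Cmod (x, y)) in *.
  specialize (E1 x ltac:(lra)); specialize (E2 y ltac:(lra)); specialize (E3 y ltac:(lra)).
  pose proof (Rabs_pos x); pose proof (Rabs_pos y).
  assert (E1m : eta * Rabs x <= eta * m) by (apply Rmult_le_compat_l; lra).
  assert (E2m : eta * Rabs y <= eta * m) by (apply Rmult_le_compat_l; lra).
  assert (Ex : Rabs (exp x - 1) <= eta).
  { apply Rabs_le; apply Rabs_le_between in E1, Hx; nra. }
  assert (Ex2 : Rabs (exp x) <= 2).
  { apply Rabs_le; apply Rabs_le_between in Ex; lra. }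
  eapply Rle_trans; [apply Cmod_le_Re_Im|]; simpl.
  replace (exp x * cos y + - (1) + - x)
    with ((exp x - 1 - 1 * x) + exp x * (cos y - 1 - 0 * y)) by ring.
  replace (exp x * sin y + - 0 + - y)
    with (exp x * (sin y - 0 - 1 * y) + (exp x - 1) * y) by ring.
  pose proof (Rabs_triang (exp x - 1 - 1 * x) (exp x * (cos y - 1 - 0 * y))) as T1.
  pose proof (Rabs_triang (exp x * (sin y - 0 - 1 * y)) ((exp x - 1) * y)) as T2.
  rewrite Rabs_mult in T1; rewrite (Rabs_mult (exp x)), (Rabs_mult (exp x - 1)) in T2.
  assert (M1 : Rabs (exp x) * Rabs (cos y - 1 - 0 * y) <= 2 * (eta * Rabs y)).
  { apply Rmult_le_compat; auto using Rabs_pos. }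
  assert (M2 : Rabs (exp x) * Rabs (sin y - 0 - 1 * y) <= 2 * (eta * Rabs y)).
  { apply Rmult_le_compat; auto using Rabs_pos. }
  assert (M3 : Rabs (exp x - 1) * Rabs y <= eta * Rabs y).
  { apply Rmult_le_compat_r; auto using Rabs_pos. }
  assert (0 <= eps * m) by (apply Rmult_le_pos; [lra | apply Cmod_ge_0]).
  assert (eta * m <= eps / 8 * m) by (apply Rmult_le_compat_r; [apply Cmod_ge_0 | lra]).
  lra.
Qed.

Lemma is_derive_cexp z : is_derive (K := C_AbsRing) (V := CK) cexp z (cexp z).
Proof.
  apply is_derive_C_intro; intros eps Heps.
  assert (Hz : 0 < Cmod (cexp z)) by (rewrite Cmod_cexp; apply exp_pos).
  destruct (cexp_near_0 (eps / Cmod (cexp z))) as [d [Hd K]].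
  { apply Rdiv_lt_0_compat; lra. }
  exists d; split; [exact Hd|]; intros w Hw; specialize (K _ Hw).
  replace w with (z + (w - z))%C at 1 by ring; rewrite cexp_plus.
  replace (cexp z * cexp (w - z) - cexp z - cexp z * (w - z))%C
    with (cexp z * (cexp (w - z) - 1 - (w - z)))%C by ring.
  rewrite Cmod_mult.
  apply (Rmult_le_compat_l (Cmod (cexp z))) in K; [|lra].
  replace (Cmod (cexp z) * (eps / Cmod (cexp z) * Cmod (w - z)))
    with (eps * Cmod (w - z)) in K by (field; lra).
  exact K.
Qed.

Lemma is_derive_Cinv (z : C) : z <> 0%C ->
  is_derive (K := C_AbsRing) (V := CK) Cinv z (- / (z * z))%C.
Proof.
  intros Hz; assert (Pz : 0 < Cmod z) by (apply Cmod_gt_0; exact Hz).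
  apply is_derive_C_intro; intros eps Heps.
  assert (P3 : 0 < Cmod z ^ 3) by (apply pow_lt; exact Pz).
  (* The first bound gives [|w| >= |z| / 2]; then the remainder [(w - z)^2 / (w z^2)] is at most
     [2 |w - z|^2 / |z|^3], whence the second bound. *)
  exists (Rmin (Cmod z / 2) (eps * Cmod z ^ 3 / 2)); split.
  { apply Rmin_pos; [lra|]; apply Rdiv_lt_0_compat; [apply Rmult_lt_0_compat|]; lra. }
  intros w Hw.
  assert (H1 := Rlt_le_trans _ _ _ Hw (Rmin_l _ _)).
  assert (H2 := Rlt_le_trans _ _ _ Hw (Rmin_r _ _)).
  assert (Pw : Cmod z / 2 <= Cmod w).
  { pose proof (Cmod_triangle w (- (w - z))) as T.
    replace (w + - (w - z))%C with z in T by ring; rewrite Cmod_opp in T; lra. }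
  assert (Hw0 : w <> 0%C) by (apply Cmod_gt_0; lra).
  replace (/ w - / z - - / (z * z) * (w - z))%C
    with ((w - z) * (w - z) * / (w * (z * z)))%C by (field; auto).
  assert (w * (z * z) <> 0)%C by (repeat apply Cmult_neq_0; auto).
  rewrite !Cmod_mult, Cmod_inv, !Cmod_mult by auto.
  pose proof (Cmod_ge_0 (w - z)) as P.
  rewrite (Rmult_comm eps), Rmult_assoc; apply Rmult_le_compat_l; [lra|].
  assert (Q : 0 < Cmod w * (Cmod z * Cmod z)) by (repeat apply Rmult_lt_0_compat; lra).
  apply Rmult_le_reg_r with (Cmod w * (Cmod z * Cmod z)); [exact Q|].
  rewrite Rmult_assoc, Rinv_l, Rmult_1_r by lra.
  assert (Cmod z / 2 * (Cmod z * Cmod z) <= Cmod w * (Cmod z * Cmod z)).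
  { apply Rmult_le_compat_r; [nra | exact Pw]. }
  nra.
Qed.

Lemma closed_form_of_derivable (F : C -> C) x0 y0 l :
  is_derive (K := C_AbsRing) (V := CK) F (x0, y0) l ->
  closed_form_at (fun x y => Re (F (x, y))) (fun x y => Im (F (x, y))) x0 y0.
Proof.
  (* The Cauchy-Riemann equations: [U_x = V_y = Re l] and [V_x = - U_y = Im l]. *)
  intros H; exists (Re l), (- Im l), (Im l); intros eps Heps.
  destruct (is_derive_C_elim _ _ _ H eps Heps) as [d [Hd K]].
  exists (d / 2); split; [lra|]; intros x y Hx Hy.
  pose proof (Cmod_le_Re_Im ((x, y) - (x0, y0))) as N; simpl in N.
  assert (N' : Cmod ((x, y) - (x0, y0)) <= Rabs (x - x0) + Rabs (y - y0)) by exact N.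
  specialize (K (x, y) ltac:(lra)).
  set (r := (F (x, y) - F (x0, y0) - l * ((x, y) - (x0, y0)))%C) in K.
  assert (B : Cmod r <= eps * (Rabs (x - x0) + Rabs (y - y0))).
  { eapply Rle_trans; [exact K|]; apply Rmult_le_compat_l; lra. }
  split; (eapply Rle_trans; [|exact B]).
  - eapply Rle_trans; [|apply (re_le_Cmod r)]; right; f_equal; unfold r, Re, Im; simpl; ring.
  - eapply Rle_trans; [|apply (Im_le_Cmod r)]; right; f_equal; unfold r, Re, Im; simpl; ring.
Qed.

(** Turns a modulus into a real part, so that integrals of real functions can bound it. *)
Lemma unimodular_rotation (z : C) : exists e : C, Cmod e = 1 /\ (e * z = RtoC (Cmod z))%C.
Proof.
  destruct (Ceq_dec z 0) as [->|Hz].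
  { exists 1%C; rewrite Cmod_1, Cmod_0; split; [reflexivity | ring]. }
  assert (P : 0 < Cmod z) by (apply Cmod_gt_0; exact Hz).
  assert (Q : RtoC (Cmod z) <> 0%C) by (intros E; apply RtoC_inj in E; lra).
  exists (Cconj z / RtoC (Cmod z))%C; split.
  - rewrite Cmod_div, Cmod_conj, Cmod_R, Rabs_pos_eq by (auto; lra); field; lra.
  - assert (E := Cmod2_conj z); rewrite RtoC_pow in E.
    replace (Cconj z / RtoC (Cmod z) * z)%C with ((z * Cconj z) / RtoC (Cmod z))%C
      by (field; exact Q).
    rewrite <- E; simpl; field; exact Q.
Qed.

Lemma is_derive_C_affine (p q z : C) :
  is_derive (K := C_AbsRing) (V := CK) (fun z => p + q * z)%C z q.
Proof.
  apply is_derive_C_intro; intros eps Heps; exists 1; split; [lra|]; intros w _.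
  replace (p + q * w - (p + q * z) - q * (w - z))%C with (RtoC 0) by ring.
  rewrite Cmod_0; apply Rmult_le_pos; [lra | apply Cmod_ge_0].
Qed.

Definition continuous_on_disc (g : C -> C) : Prop :=
  forall z : C, Cmod z <= 1 -> forall eps, 0 < eps -> exists delta, 0 < delta /\
    forall w : C, Cmod w <= 1 -> Cmod (w - z) < delta -> Cmod (g w - g z) < eps.

Lemma Cmod_cexp_le_1 z : Re z <= 0 -> Cmod (cexp z) <= 1.
Proof.
  intros Hz; rewrite Cmod_cexp, <- exp_0; destruct (Req_dec (Re z) 0) as [->|]; [lra|].
  apply Rlt_le, exp_increasing; lra.
Qed.

(** Continuity in the plane needs a full neighbourhood, also at [x = 0], while [g] is controlled
    only on the closed disc; the clamp [Rmin x 0], which is 1-Lipschitz, keeps [cexp] inside it. *)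
Lemma continuity_2d_pt_Re_cexp (e : C) (g : C -> C) x0 y0 :
  Cmod e = 1 -> continuous_on_disc g ->
  continuity_2d_pt (fun x y => Re (e * g (cexp (Rmin x 0, y)))) x0 y0.
Proof.
  intros He Hg eps.
  set (z0 := (Rmin x0 0, y0) : C).
  destruct (Hg (cexp z0)) with (eps := pos eps) as [d1 [Hd1 K1]].
  { apply Cmod_cexp_le_1; apply Rmin_r. } { apply cond_pos. }
  destruct (is_derive_C_elim _ _ _ (is_derive_cexp z0) 1 Rlt_0_1) as [d2 [Hd2 K2]].
  (* Differentiability with error 1 makes [c] a local Lipschitz constant of [cexp] at [z0]. *)
  set (c := Cmod (cexp z0) + 1) in *.
  assert (Hc : 0 < c) by (pose proof (Cmod_ge_0 (cexp z0)); unfold c; lra).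
  set (d := Rmin d2 (d1 / c)).
  assert (Hd : 0 < d) by (apply Rmin_pos; [lra | apply Rdiv_lt_0_compat; lra]).
  exists (mkposreal (d / 2) ltac:(lra)); simpl; intros x y Hx Hy.
  set (z := (Rmin x 0, y) : C).
  assert (Hz : Cmod (z - z0) < d).
  { eapply Rle_lt_trans; [apply Cmod_le_Re_Im|]; simpl.
    change (Rabs (Rmin x 0 - Rmin x0 0) + Rabs (y - y0) < d).
    assert (Rabs (Rmin x 0 - Rmin x0 0) <= Rabs (x - x0)); [|lra].
    unfold Rmin; do 2 destruct Rle_dec; apply Rabs_le;
      pose proof (Rle_abs (x - x0)); pose proof (Rle_abs (- (x - x0)));
      rewrite Rabs_Ropp in *; lra. }
  assert (Hz2 := Rlt_le_trans _ _ _ Hz (Rmin_l _ _)).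
  assert (Hz1 := Rlt_le_trans _ _ _ Hz (Rmin_r _ _)).
  specialize (K2 z Hz2).
  assert (L : Cmod (cexp z - cexp z0) < d1).
  { pose proof (Cmod_triangle (cexp z - cexp z0 - cexp z0 * (z - z0)) (cexp z0 * (z - z0))) as T.
    replace (cexp z - cexp z0 - cexp z0 * (z - z0) + cexp z0 * (z - z0))%C
      with (cexp z - cexp z0)%C in T by ring.
    rewrite (Cmod_mult (cexp z0)) in T.
    apply (Rmult_lt_compat_r c) in Hz1; [|lra].
    replace (d1 / c * c) with d1 in Hz1 by (field; lra); unfold c in Hz1; lra. }
  specialize (K1 (cexp z) (Cmod_cexp_le_1 z (Rmin_r _ _)) L).
  eapply Rle_lt_trans; [|exact K1].
  rewrite <- (Rmult_1_l (Cmod _)), <- He, <- Cmod_mult.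
  eapply Rle_trans; [|apply re_le_Cmod]; right; f_equal.
  unfold z, z0, Re; simpl; ring.
Qed.

(* [z |-> g (cexp z)] is [2 i PI]-periodic, so by Goursat's theorem on the rectangles
   [a,b] x [0, 2 PI] the circular means of [g] do not depend on the radius. *)
Lemma disc_center_bound (g : C -> C) M :
  (forall z : C, Cmod z < 1 -> ex_derive (K := C_AbsRing) (V := CK) g z) ->
  continuous_on_disc g ->
  (forall z : C, Cmod z = 1 -> Cmod (g z) <= M) ->
  Cmod (g 0%C) <= M.
Proof.
  intros Hd Hc Hb; apply le_epsilon; intros eps2 Heps2.
  set (eps := eps2 / 2); assert (Heps : 0 < eps) by (unfold eps; lra).
  destruct (unimodular_rotation (g 0%C)) as (e & He & Ee).
  set (U := fun x y => Re (e * g (cexp (x, y)))).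
  set (V := fun x y => Im (e * g (cexp (x, y)))).
  destruct (Hc 0%C) with (eps := eps) as [d0 [Hd0 K0]]; auto.
  { rewrite Cmod_0; lra. }
  (* Uniformity in [y] carries the bound on the unit circle, [x = 0], to a slightly smaller circle,
     on which [g] is differentiable. *)
  destruct (uniform_continuity_2d _ (-1) 0 0 (2 * PI)
    (fun x y _ _ => continuity_2d_pt_Re_cexp e g x y He Hc) (mkposreal eps Heps))
    as [d1 K1].
  pose proof PI_RGT_0 as HPI.
  (* The circle of radius [exp b] is close to the unit circle; that of radius [exp a] lies where [g]
     is within [eps] of [g 0]. *)
  set (b := - (Rmin d1 1 / 2)).
  assert (Hm : 0 < Rmin d1 1) by (apply Rmin_pos; [apply cond_pos | lra]).
  assert (b < 0 /\ -1 <= b /\ - d1 < b) as (Hb0 & Hb1 & Hb2).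
  { pose proof (Rmin_l d1 1); pose proof (Rmin_r d1 1); unfold b; lra. }
  set (a := Rmin (-2) (ln d0 - 1)).
  assert (a <= -2) by apply Rmin_l.
  assert (Ha : exp a < d0).
  { rewrite <- (exp_ln d0 Hd0); apply exp_increasing.
    pose proof (Rmin_r (-2) (ln d0 - 1)) as Q; fold a in Q; lra. }
  assert (CF : forall x y, a <= x <= b -> 0 <= y <= 2 * PI -> closed_form_at U V x y).
  { intros x y Hx _.
    assert (HD : ex_derive (K := C_AbsRing) (V := CK) (fun z => e * g (cexp z))%C (x, y)).
    { destruct (Hd (cexp (x, y))) as [l Hl].
      { rewrite Cmod_cexp, <- exp_0; apply exp_increasing; simpl; lra. }
      pose proof (is_derive_comp (K := C_AbsRing) (V := CK) g cexp (x, y) _ _ Hl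
                   (is_derive_cexp (x, y))) as HC.
      pose proof (is_derive_comp (K := C_AbsRing) (V := CK) _ _ (x, y) _ _
                   (is_derive_C_affine 0 e (g (cexp (x, y)))) HC) as HC2.
      eexists; eapply (is_derive_ext (K := C_AbsRing) (V := CK)); [|exact HC2].
      intros t; simpl; ring. }
    destruct HD as [l Hl]; exact (closed_form_of_derivable _ _ _ _ Hl). }
  assert (G := goursat U V a b 0 (2 * PI) CF ltac:(lra) ltac:(lra)).
  unfold circulation in G.
  (* By periodicity the horizontal sides cancel, so the integrals of [U] over the two vertical sides
     agree. *)
  assert (P : RInt (fun x => V x 0) a b = RInt (fun x => V x (2 * PI)) a b).
  { apply RInt_ext; intros x _; unfold V, cexp; simpl.
    rewrite cos_2PI, sin_2PI, cos_0, sin_0; reflexivity. }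
  rewrite P in G.
  assert (Ia : RInt (fun _ => Cmod (g 0%C) - eps) 0 (2 * PI) <= RInt (fun y => U a y) 0 (2 * PI)).
  { apply RInt_le; [lra|apply ex_RInt_const| |].
    - apply (ex_RInt_U _ _ _ _ _ _ CF); lra.
    - intros y Hy; unfold U.
      specialize (K0 (cexp (a, y))).
      assert (E : Cmod (cexp (a, y)) = exp a) by apply Cmod_cexp.
      assert (E1 : exp a < 1) by (rewrite <- exp_0; apply exp_increasing; lra).
      replace (cexp (a, y) - 0)%C with (cexp (a, y)) in K0 by ring.
      rewrite E in K0; specialize (K0 ltac:(lra) Ha).
      pose proof (re_le_Cmod (e * (g (cexp (a, y)) - g 0%C))) as R1.
      rewrite Cmod_mult, He, Rmult_1_l in R1.
      replace (e * (g (cexp (a, y)) - g 0%C))%C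
        with (e * g (cexp (a, y)) - e * g 0%C)%C in R1 by ring.
      rewrite Ee in R1; unfold Cminus in R1, K0; rewrite re_plus, re_opp, re_RtoC in R1.
      apply Rabs_le_between in R1; lra. }
  assert (Ib : RInt (fun y => U b y) 0 (2 * PI) <= RInt (fun _ => M + eps) 0 (2 * PI)).
  { apply RInt_le; [lra| |apply ex_RInt_const|].
    - apply (ex_RInt_U _ _ _ _ _ _ CF); lra.
    - intros y Hy; unfold U.
      specialize (K1 0 y b y ltac:(lra) ltac:(lra) ltac:(lra) ltac:(lra)).
      rewrite Rminus_diag, Rabs_R0 in K1.
      specialize (K1 ltac:(pose proof (cond_pos d1); apply Rabs_def1; lra) (cond_pos d1)).
      simpl pos in K1.
      rewrite (Rmin_left b 0), (Rmin_left 0 0) in K1 by lra.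
      assert (B0 : Re (e * g (cexp (0, y))) <= M).
      { eapply Rle_trans; [apply Rle_abs|]; eapply Rle_trans; [apply re_le_Cmod|].
        rewrite Cmod_mult, He, Rmult_1_l; apply Hb; rewrite Cmod_cexp; simpl; apply exp_0. }
      apply Rabs_lt_between in K1; lra. }
  rewrite !RInt_const in *; unfold scal in *; simpl in *; unfold mult in *; simpl in *.
  assert (Cmod (g 0%C) - eps <= M + eps); [|unfold eps in *; lra].
  apply Rmult_le_reg_l with (2 * PI - 0); lra.
Qed.

(** * Automorphisms of the disc sending 0 to [a], and the passage from the centre to any point *)

Definition mobius (a z : C) : C := ((z + a) / (1 + Cconj a * z))%C.

Lemma mobius_denominator a z : Cmod a < 1 -> Cmod z <= 1 ->
  1 - Cmod a <= Cmod (1 + Cconj a * z).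
Proof.
  intros Ha Hz.
  pose proof (Cmod_triangle (1 + Cconj a * z) (- (Cconj a * z))) as T.
  replace (1 + Cconj a * z + - (Cconj a * z))%C with (RtoC 1) in T by ring.
  rewrite Cmod_1, Cmod_opp, Cmod_mult, Cmod_conj in T.
  pose proof (Cmod_ge_0 a).
  assert (Cmod a * Cmod z <= Cmod a * 1) by (apply Rmult_le_compat_l; lra); lra.
Qed.

(** Divided by [|1 + Cconj a * z|^2], the left side is [1 - |mobius a z|^2]; the sign of the right
    side then gives all three parts of [mobius_disc]. *)
Lemma mobius_identity a z :
  Cmod (1 + Cconj a * z) ^ 2 - Cmod (z + a) ^ 2 = (1 - Cmod a ^ 2) * (1 - Cmod z ^ 2).
Proof. rewrite !Cmod2_alt; destruct a, z; simpl; ring. Qed.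

Lemma Cmod_mobius a z : Cmod a < 1 -> Cmod z <= 1 ->
  Cmod (mobius a z) * Cmod (1 + Cconj a * z) = Cmod (z + a).
Proof.
  intros Ha Hz; pose proof (mobius_denominator a z Ha Hz).
  assert (1 + Cconj a * z <> 0)%C by (apply Cmod_gt_0; lra).
  rewrite <- Cmod_mult; f_equal; unfold mobius; field; auto.
Qed.

Lemma mobius_disc a z : Cmod a < 1 ->
  (Cmod z < 1 -> Cmod (mobius a z) < 1) /\ (Cmod z <= 1 -> Cmod (mobius a z) <= 1) /\
  (Cmod z = 1 -> Cmod (mobius a z) = 1).
Proof.
  intros Ha; pose proof (Cmod_ge_0 a); pose proof (Cmod_ge_0 z).
  pose proof (mobius_identity a z) as I; pose proof (Cmod_ge_0 (mobius a z)).
  pose proof (fun h => mobius_denominator a z Ha h) as D.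
  pose proof (fun h => Cmod_mobius a z Ha h) as E.
  assert (0 < 1 - Cmod a ^ 2) by nra.
  repeat split; intros Hz; specialize (D ltac:(lra)); specialize (E ltac:(lra)); rewrite <- E in I;
    set (m := Cmod (mobius a z)) in *; set (n := Cmod (1 + Cconj a * z)) in *;
    assert (Pn : 0 < n ^ 2) by (apply pow_lt; lra);
    assert (I' : n ^ 2 * (1 - m ^ 2) = (1 - Cmod a ^ 2) * (1 - Cmod z ^ 2)) by lra.
  - assert (0 < (1 - Cmod a ^ 2) * (1 - Cmod z ^ 2)) by (apply Rmult_lt_0_compat; nra).
    apply Rnot_le_lt; intros K; assert (1 - m ^ 2 <= 0) by nra; nra.
  - assert (0 <= (1 - Cmod a ^ 2) * (1 - Cmod z ^ 2)) by (apply Rmult_le_pos; nra).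
    apply Rnot_lt_le; intros K; assert (1 - m ^ 2 < 0) by nra; nra.
  - rewrite Hz in I'; replace (1 - 1 ^ 2) with 0 in I' by ring; rewrite Rmult_0_r in I'.
    apply Rmult_integral in I'; destruct I'; nra.
Qed.

(** The difference of the two values is [(1 - |a|^2) (w - z)] over the two denominators, each of
    modulus at least [1 - |a|]. This transfers continuity on the closed disc. *)
Lemma mobius_lipschitz a z w : Cmod a < 1 -> Cmod z <= 1 -> Cmod w <= 1 ->
  Cmod (mobius a w - mobius a z) * (1 - Cmod a) ^ 2 <= Cmod (w - z).
Proof.
  intros Ha Hz Hw.
  pose proof (mobius_denominator a z Ha Hz) as Dz; pose proof (mobius_denominator a w Ha Hw) as Dw.
  assert (1 + Cconj a * z <> 0)%C by (apply Cmod_gt_0; lra).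
  assert (1 + Cconj a * w <> 0)%C by (apply Cmod_gt_0; lra).
  pose proof (Cmod_ge_0 a) as Pa.
  assert (E : ((mobius a w - mobius a z) * ((1 + Cconj a * w) * (1 + Cconj a * z))
     = (1 - a * Cconj a) * (w - z))%C) by (unfold mobius; field; auto).
  apply (f_equal Cmod) in E; rewrite !Cmod_mult in E.
  assert (N : Cmod (1 - a * Cconj a) <= 1).
  { rewrite <- Cmod2_conj.
    rewrite <- RtoC_minus, Cmod_R; apply Rabs_le; nra. }
  pose proof (Cmod_ge_0 (mobius a w - mobius a z)) as P.
  apply Rle_trans with
    (Cmod (mobius a w - mobius a z) * (Cmod (1 + Cconj a * w) * Cmod (1 + Cconj a * z))).
  - apply Rmult_le_compat_l; [exact P|]; nra.
  - rewrite E; pose proof (Cmod_ge_0 (w - z)); nra.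
Qed.

Lemma maximum_modulus_disc (g : C -> C) M :
  (forall z : C, Cmod z < 1 -> ex_derive (K := C_AbsRing) (V := CK) g z) ->
  continuous_on_disc g ->
  (forall z : C, Cmod z = 1 -> Cmod (g z) <= M) ->
  forall a, Cmod a < 1 -> Cmod (g a) <= M.
Proof.
  intros Hd Hc Hb a Ha.
  assert (E : mobius a 0 = a).
  { unfold mobius; field; apply Cmod_gt_0; rewrite Cmult_0_r, Cplus_0_r, Cmod_1; lra. }
  rewrite <- E; apply (disc_center_bound (fun z => g (mobius a z))).
  - intros z Hz; destruct (mobius_disc a z Ha) as [H1 _].
    apply (ex_derive_comp (K := C_AbsRing) (V := CK) g (mobius a)); [apply Hd, H1, Hz|].
    pose proof (mobius_denominator a z Ha ltac:(lra)).
    assert (Dz : (1 + Cconj a * z <> 0)%C) by (apply Cmod_gt_0; lra).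
    pose proof (is_derive_comp (K := C_AbsRing) (V := CK) Cinv _ z _ _
      (is_derive_Cinv _ Dz) (is_derive_C_affine 1%C (Cconj a) z)) as HI.
    pose proof (is_derive_mult (K := C_AbsRing) _ _ z _ _ (is_derive_C_affine a 1%C z) HI Cmult_comm) as HM.
    eexists; eapply (is_derive_ext (K := C_AbsRing) (V := CK)); [|exact HM].
    intros w; unfold mobius, Cdiv; simpl; unfold mult; simpl; ring.
  - intros z Hz eps Heps.
    destruct (Hc (mobius a z)) with (eps := eps) as [d [Hd0 K]]; auto.
    { apply (mobius_disc a z Ha); exact Hz. }
    assert (P : 0 < (1 - Cmod a) ^ 2) by (apply pow_lt; lra).
    exists (d * (1 - Cmod a) ^ 2); split; [apply Rmult_lt_0_compat; lra|].
    intros w Hw Hwz; apply K; [apply (mobius_disc a w Ha); exact Hw|].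
    pose proof (mobius_lipschitz a z w Ha Hz Hw).
    apply Rmult_lt_reg_r with ((1 - Cmod a) ^ 2); lra.
  - intros z Hz; apply Hb; apply (mobius_disc a z Ha); exact Hz.
Qed.

(** * The unit sphere is a boundary *)

(** Both structures have the same operations and norm, so only the linearity record has to be
    rebuilt. *)
Lemma filterdiff_C_codomain (X : NormedModule C_AbsRing) (f : X -> C) F (l : X -> C) :
  filterdiff (V := C_NormedModule) f F l <-> filterdiff (V := CK) f F l.
Proof. split; intros [[L1 L2 L3] H]; split; try exact H; split; assumption. Qed.

Lemma plus_minus_cancel (G : AbelianGroup) (x y : G) : plus y (minus x y) = x.
Proof. unfold minus; rewrite (plus_comm x), plus_assoc, plus_opp_r; apply plus_zero_l. Qed.

Section Normed.

Variable X : NormedModule C_AbsRing.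

Lemma scal_C_inv (a : C) (x : X) : a <> 0%C -> scal (/ a)%C (scal a x) = x.
Proof.
  intros Ha; rewrite scal_assoc; transitivity (scal (@one C_AbsRing) x); [|apply scal_one].
  apply (f_equal (fun k => scal k x)); exact (Cinv_l a Ha).
Qed.

(** The reverse of [norm_scal] is [norm_scal] itself for the inverse scalar. *)
Lemma norm_scal_C (a : C) (x : X) : norm (scal a x) = Cmod a * norm x.
Proof.
  apply Rle_antisym; [exact (norm_scal a x)|].
  destruct (Ceq_dec a 0) as [->|Ha]; [rewrite Cmod_0, Rmult_0_l; apply norm_ge_0|].
  assert (P : 0 < Cmod a) by (apply Cmod_gt_0; exact Ha).
  pose proof (norm_scal (/ a)%C (scal a x)) as N.
  rewrite scal_C_inv in N by exact Ha.
  change (norm x <= Cmod (/ a) * norm (scal a x)) in N.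
  rewrite Cmod_inv in N by exact Ha.
  apply (Rmult_le_compat_l (Cmod a)) in N; [|lra].
  rewrite <- Rmult_assoc, Rinv_r, Rmult_1_l in N by lra; exact N.
Qed.

Lemma locally_iff_norm (x : X) (P : X -> Prop) :
  locally x P <-> exists d, 0 < d /\ forall y, norm (minus y x) < d -> P y.
Proof.
  split.
  - intros H; apply locally_norm_le_locally in H as [d H]; exists d; split; [apply cond_pos | exact H].
  - intros (d & Hd & H); apply locally_le_locally_norm; exists (mkposreal d Hd); exact H.
Qed.

Lemma norm_le_add_minus (x y : X) : norm x <= norm y + norm (minus x y).
Proof.
  rewrite <- (plus_minus_cancel (NormedModule.AbelianGroup _ X) x y) at 1.
  apply norm_triangle.
Qed.

Lemma interior_unit_ball (x : X) : norm x < 1 -> locally x (unit_ball X).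
Proof.
  intros Hx; apply locally_iff_norm; exists (1 - norm x); split; [lra|]; intros y Hy.
  pose proof (norm_le_add_minus y x); unfold unit_ball; lra.
Qed.

Lemma continuous_on_eps (D : X -> Prop) (f : X -> C) :
  continuous_on (U := C_UniformSpace) D f <->
  forall x, D x -> forall eps, 0 < eps -> exists d, 0 < d /\
    forall y, D y -> norm (minus y x) < d -> Cmod (f y - f x) < eps.
Proof.
  split; intros H x Hx.
  - intros eps Heps; specialize (H x Hx (fun c => Cmod (c - f x) < eps)).
    assert (L : locally (T := C_UniformSpace) (f x) (fun c => Cmod (c - f x) < eps)).
    { apply (locally_le_locally_norm (V := C_NormedModule)); exists (mkposreal eps Heps).
      intros c Hc; exact Hc. }
    apply H in L; apply locally_iff_norm in L as (d & Hd & L); exists d; split; auto.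
  - intros P HP; apply (locally_norm_le_locally (V := C_NormedModule)) in HP as [e HP].
    destruct (H x Hx e (cond_pos e)) as (d & Hd & K).
    apply locally_iff_norm; exists d; split; [exact Hd|]; intros y Hy Dy.
    apply HP; exact (K y Dy Hy).
Qed.

Lemma sup_mod_ub (F : X -> Prop) f x : F x -> Rbar_le (Cmod (f x)) (sup_mod X F f).
Proof. intros Hx; apply (proj1 (Lub_Rbar_correct _)); exists x; auto. Qed.

Lemma sup_mod_least (F : X -> Prop) f (b : Rbar) :
  (forall x, F x -> Rbar_le (Cmod (f x)) b) -> Rbar_le (sup_mod X F f) b.
Proof. intros H; apply (proj2 (Lub_Rbar_correct _)); intros r (x & Hx & ->); auto. Qed.

Lemma norm_pos (x : X) : x <> zero -> 0 < norm x.
Proof.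
  intros Hx; destruct (norm_ge_0 x) as [P|P]; [exact P|]; symmetry in P.
  apply norm_eq_zero in P; contradiction.
Qed.

(** A nonzero [x] is normalised; for [x = 0] the direction comes from the given nonzero vector, with
    [l = 0]. *)
Lemma exists_unit_direction (x : X) : (exists y : X, y <> zero) ->
  exists (u : X) (l : C), norm u = 1 /\ x = scal l u.
Proof.
  intros [y Hy].
  assert (U : forall z : X, z <> zero -> norm (scal (RtoC (/ norm z)) z) = 1 /\
    z = scal (RtoC (norm z)) (scal (RtoC (/ norm z)) z)).
  { intros z Hz; pose proof (norm_pos z Hz) as P.
    split.
    - rewrite norm_scal_C, Cmod_R, Rabs_pos_eq by (apply Rlt_le, Rinv_0_lt_compat, P).
      apply Rinv_l; lra.
    - rewrite scal_assoc; transitivity (scal (@one C_AbsRing) z); [symmetry; apply scal_one|].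
      apply (f_equal (fun k => scal k z)).
      change (RtoC 1 = RtoC (norm z) * RtoC (/ norm z))%C.
      rewrite <- RtoC_mult, Rinv_r; [reflexivity | lra]. }
  destruct (classic (x = zero)) as [->|Hx].
  - exists (scal (RtoC (/ norm y)) y), (@zero C_AbsRing); split; [apply U, Hy|].
    symmetry; apply norm_eq_zero; rewrite norm_scal_C.
    change (Cmod 0 * norm (scal (RtoC (/ norm y)) y) = 0); rewrite Cmod_0; ring.
  - exists (scal (RtoC (/ norm x)) x), (RtoC (norm x)); apply U, Hx.
Qed.

Lemma unit_sphere_boundary_b : (exists x : X, x <> zero) ->
  boundary X (algebra_b X) (unit_sphere X).
Proof.
  intros hne; split; [intros x Hx; right; exact Hx|].
  intros f (_ & Hc & Hd).
  apply Rbar_le_antisym.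
  2:{ apply sup_mod_least; intros x Hx; apply sup_mod_ub; right; exact Hx. }
  apply sup_mod_least; intros x Hx.
  (* On the complex line through [u] the closed unit disc parametrizes points of the ball, and its
     circle lies in the sphere. *)
  destruct (exists_unit_direction x hne) as (u & l & Hu & ->).
  unfold unit_ball in Hx; rewrite norm_scal_C, Hu, Rmult_1_r in Hx.
  assert (UB : forall z : C, Cmod z = 1 ->
    Rbar_le (Cmod (f (scal z u))) (sup_mod X (unit_sphere X) f)).
  { intros z Hz; apply sup_mod_ub; unfold unit_sphere; rewrite norm_scal_C, Hu; lra. }
  destruct Hx as [Hx|Hx]; [|apply UB, Hx].
  (* An infinite supremum bounds everything, and [m_infty] is excluded because [u] lies on the
     sphere. *)
  destruct (sup_mod X (unit_sphere X) f) as [M| |]; [|exact I|destruct (UB 1%C Cmod_1)].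
  apply (maximum_modulus_disc (fun z => f (scal z u))); auto.
  - intros z Hz.
    destruct (Hd (scal z u)) as [k Hk].
    { apply interior_unit_ball; rewrite norm_scal_C, Hu; lra. }
    apply filterdiff_C_codomain in Hk.
    pose proof (filterdiff_comp' (U := CK) (V := X) (W := CK) (fun z => scal z u) f z _ _
      (filterdiff_linear _ (is_linear_scal_l u)) Hk) as HC.
    exists (k u); eapply filterdiff_ext_lin; [exact HC|].
    intros y; exact (@linear_scal C_AbsRing X CK k (proj1 Hk) y u).
  - intros z Hz eps Heps.
    destruct (proj1 (continuous_on_eps _ _) Hc (scal z u)) with (eps := eps) as (d & Hd0 & K); auto.
    { unfold unit_ball; rewrite norm_scal_C, Hu; lra. }
    exists d; split; [exact Hd0|]; intros w Hw Hwz; apply K.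
    { unfold unit_ball; rewrite norm_scal_C, Hu; lra. }
    eapply Rle_lt_trans; [right; apply f_equal; exact (eq_sym (@scal_minus_distr_r C_Ring X w z u))|].
    change (norm (scal (w - z)%C u) < d); rewrite norm_scal_C, Hu; lra.
Qed.

End Normed.

(** * Norming functionals *)

Section Sublinear.

Variable V : ModuleSpace C_Ring.

(** Scalars are nonnegative reals, since the Hahn-Banach argument is run over the reals;
    [sublinear_scal] recovers equality in the homogeneity. *)
Definition sublinear (q : V -> R) : Prop :=
  (forall x y, q (plus x y) <= q x + q y) /\
  (forall (t : R) x, 0 <= t -> q (scal (RtoC t) x) <= t * q x).

Lemma scal_RtoC_mult (s t : R) (x : V) :
  scal (RtoC s) (scal (RtoC t) x) = scal (RtoC (s * t)) x.
Proof. rewrite RtoC_mult; exact (scal_assoc (V := V) (RtoC s) (RtoC t) x). Qed.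

Lemma scal_RtoC_plus (s t : R) (x : V) :
  scal (RtoC (s + t)) x = plus (scal (RtoC s) x) (scal (RtoC t) x).
Proof. rewrite RtoC_plus; exact (scal_distr_r (V := V) (RtoC s) (RtoC t) x). Qed.

Lemma scal_RtoC_1 (x : V) : scal (RtoC 1) x = x.
Proof. exact (scal_one (V := V) x). Qed.

Lemma scal_RtoC_0 (x : V) : scal (RtoC 0) x = zero.
Proof. exact (scal_zero_l (V := V) x). Qed.

Lemma vector_opp_r (x : V) : plus x (opp x) = zero.
Proof. exact (plus_opp_r (G := V) x). Qed.

Lemma sublinear_zero q : sublinear q -> q zero = 0.
Proof.
  intros [Q1 Q2]; pose proof (Q2 0 zero (Rle_refl 0)) as H.
  rewrite scal_RtoC_0, Rmult_0_l in H.
  pose proof (Q1 zero zero) as H'; rewrite plus_zero_r in H'; lra.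
Qed.

Lemma sublinear_scal q t x : sublinear q -> 0 <= t -> q (scal (RtoC t) x) = t * q x.
Proof.
  intros Q Ht; destruct (Rle_lt_or_eq_dec 0 t Ht) as [P | <-].
  - apply Rle_antisym; [apply Q, Ht|].
    pose proof (proj2 Q (/ t) (scal (RtoC t) x)) as H.
    rewrite scal_RtoC_mult, Rinv_l, scal_RtoC_1 in H by lra.
    specialize (H (Rlt_le _ _ (Rinv_0_lt_compat _ P))).
    apply (Rmult_le_compat_l t) in H; [|lra].
    rewrite <- Rmult_assoc, Rinv_r, Rmult_1_l in H by lra; exact H.
  - rewrite scal_RtoC_0, (sublinear_zero q Q); ring.
Qed.

Lemma sublinear_opp_ge q x : sublinear q -> - q x <= q (opp x).
Proof.
  intros Q; pose proof (proj1 Q x (opp x)) as H.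
  rewrite vector_opp_r, (sublinear_zero q Q) in H; lra.
Qed.

(* [q' x] is the infimum of [q (x + t v) - t q v] over [t >= 0]. *)
Lemma sublinear_linearize q v : sublinear q ->
  exists q', sublinear q' /\ (forall x, q' x <= q x) /\ q' (opp v) <= - q v.
Proof.
  intros Q.
  set (E := fun x r => exists t, 0 <= t /\ r = q (plus x (scal (RtoC t) v)) - t * q v).
  set (q' := fun x => real (Glb_Rbar (E x))).
  (* [real] would return a default value at an infinite infimum. Here [t = 0] bounds it above and
     [- q (opp x)] bounds it below, by subadditivity. *)
  assert (G : forall x, is_glb_Rbar (E x) (Finite (q' x))).
  { intros x; unfold q'.
    pose proof (Glb_Rbar_correct (E x)) as [G1 G2].
    assert (E0 : E x (q (plus x (scal (RtoC 0) v)) - 0 * q v)) by (exists 0; split; [lra | auto]).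
    apply G1 in E0.
    assert (LB : is_lb_Rbar (E x) (Finite (- q (opp x)))).
    { intros r (t & Ht & ->); simpl.
      pose proof (proj1 Q (plus x (scal (RtoC t) v)) (opp x)) as H.
      rewrite (plus_comm x), <- plus_assoc, vector_opp_r, plus_zero_r in H.
      rewrite (sublinear_scal q t v Q Ht), (plus_comm _ x) in H; lra. }
    apply G2 in LB.
    destruct (Glb_Rbar (E x)) eqn:EG; simpl in *; try contradiction.
    rewrite <- EG; apply Glb_Rbar_correct. }
  assert (G1 : forall x t, 0 <= t -> q' x <= q (plus x (scal (RtoC t) v)) - t * q v).
  { intros x t Ht; apply (proj1 (G x)); exists t; auto. }
  assert (G2 : forall x m, (forall t, 0 <= t -> m <= q (plus x (scal (RtoC t) v)) - t * q v) ->
    m <= q' x).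
  { intros x m H; apply (proj2 (G x) (Finite m)); intros r (t & Ht & ->); apply H, Ht. }
  exists q'; split; [split|split].
  - intros x y.
    assert (q' (plus x y) - q' y <= q' x); [|lra].
    apply G2; intros s Hs.
    assert (q' (plus x y) - (q (plus x (scal (RtoC s) v)) - s * q v) <= q' y); [|lra].
    apply G2; intros t Ht.
    pose proof (G1 (plus x y) (s + t) ltac:(lra)) as H.
    pose proof (proj1 Q (plus x (scal (RtoC s) v)) (plus y (scal (RtoC t) v))) as H'.
    replace (plus (plus x (scal (RtoC s) v)) (plus y (scal (RtoC t) v)))
      with (plus (plus x y) (scal (RtoC (s + t)) v)) in H'; [lra|].
    rewrite scal_RtoC_plus, <- !plus_assoc; f_equal.
    rewrite !plus_assoc; f_equal; apply plus_comm.
  - intros c x Hc; destruct (Rle_lt_or_eq_dec 0 c Hc) as [P | <-].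
    + assert (/ c * q' (scal (RtoC c) x) <= q' x) as H.
      { apply G2; intros t Ht.
        assert (Hct : 0 <= c * t) by (apply Rmult_le_pos; lra).
        pose proof (G1 (scal (RtoC c) x) (c * t) Hct) as H.
        rewrite <- scal_RtoC_mult, <- scal_distr_l, (sublinear_scal q c _ Q Hc) in H.
        apply (Rmult_le_compat_l (/ c)) in H; [|apply Rlt_le, Rinv_0_lt_compat, P].
        replace (/ c * (c * q (plus x (scal (RtoC t) v)) - c * t * q v))
          with (q (plus x (scal (RtoC t) v)) - t * q v) in H by (field; lra).
        exact H. }
      apply (Rmult_le_compat_l c) in H; [|lra].
      rewrite <- Rmult_assoc, Rinv_r, Rmult_1_l in H by lra; exact H.
    + pose proof (G1 (scal (RtoC 0) x) 0 (Rle_refl 0)) as H.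
      rewrite !scal_RtoC_0, plus_zero_r, (sublinear_zero q Q) in H; rewrite scal_RtoC_0; lra.
  - intros x; pose proof (G1 x 0 (Rle_refl 0)) as H.
    rewrite scal_RtoC_0, plus_zero_r in H; lra.
  (* With [t = 1] the vector [opp v + t v] vanishes. *)
  - pose proof (G1 (opp v) 1 Rle_0_1) as H.
    rewrite scal_RtoC_1, plus_comm, vector_opp_r, (sublinear_zero q Q) in H; lra.
Qed.

(* A Hahn-Banach functional on the real span of [p, v 0, ..., v n]. *)
Lemma sublinear_support q p (v : nat -> V) n : sublinear q ->
  exists q', sublinear q' /\ (forall x, q' x <= q x) /\ q p <= q' p /\
    forall j, (j <= n)%nat -> q' (opp (v j)) <= - q' (v j).
Proof.
  intros Q.
  assert (H : exists q', sublinear q' /\ (forall x, q' x <= q x) /\ q' (opp p) <= - q p /\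
    forall j, (j < S n)%nat -> q' (opp (v j)) <= - q' (v j)).
  { induction (S n) as [|m (q1 & Q1 & L1 & P1 & N1)].
    - destruct (sublinear_linearize q p Q) as (q1 & Q1 & L1 & P1).
      exists q1; repeat split; auto; try apply Q1; intros; lia.
    - destruct (sublinear_linearize q1 (v m) Q1) as (q2 & Q2 & L2 & P2).
      exists q2; split; [exact Q2|]; split; [|split].
      + intros x; eapply Rle_trans; [apply L2 | apply L1].
      + eapply Rle_trans; [apply L2 | exact P1].
      (* Lowering the functional preserves the inequalities already obtained: its values at both
         [v j] and [opp (v j)] can only decrease. *)
      + intros j Hj; pose proof (L2 (v j)); pose proof (L2 (opp (v j))).
        destruct (Nat.eq_dec j m) as [->|]; [lra|].
        specialize (N1 j ltac:(lia)); lra. }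
  destruct H as (q' & Q' & L' & P' & N'); exists q'.
  split; [exact Q'|]; split; [exact L'|]; split.
  - pose proof (sublinear_opp_ge q' p Q'); lra.
  - intros j Hj; apply N'; lia.
Qed.

Lemma sublinear_sum_le q (v : nat -> V) n : sublinear q ->
  q (sum_n v n) <= sum_n (fun j => q (v j)) n.
Proof.
  intros Q; induction n as [|n IH]; [rewrite !sum_O; lra|].
  rewrite !sum_Sn; pose proof (proj1 Q (sum_n v n) (v (S n))).
  unfold plus in *; simpl in *; lra.
Qed.

(** Removing [r j] times [v j] from the sum by subadditivity costs [r j * q (opp (v j))], which the
    hypothesis bounds by [- r j * q (v j)]. *)
Lemma sublinear_sum_ge q (v : nat -> V) (r : nat -> R) n : sublinear q ->
  (forall j, (j <= n)%nat -> q (opp (v j)) <= - q (v j)) -> (forall j, 0 <= r j) ->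
  sum_n (fun j => r j * q (v j)) n <= q (sum_n (fun j => scal (RtoC (r j)) (v j)) n).
Proof.
  intros Q H Hr; induction n as [|n IH].
  - rewrite !sum_O, (sublinear_scal q _ _ Q (Hr O)); lra.
  - rewrite !sum_Sn; specialize (IH (fun j Hj => H j (le_S _ _ Hj))).
    set (x := sum_n (fun j => scal (RtoC (r j)) (v j)) n) in *.
    set (b := sum_n (fun j => r j * q (v j)) n) in *.
    pose proof (proj1 Q (plus x (scal (RtoC (r (S n))) (v (S n))))
                        (scal (RtoC (r (S n))) (opp (v (S n))))) as T.
    rewrite <- plus_assoc, <- scal_distr_l, vector_opp_r, scal_zero_r, plus_zero_r in T.
    rewrite (sublinear_scal q _ (opp (v (S n))) Q (Hr _)) in T.
    pose proof (Rmult_le_compat_l _ _ _ (Hr (S n)) (H (S n) (le_n _))).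
    change (b + r (S n) * q (v (S n)) <= q (plus x (scal (RtoC (r (S n))) (v (S n))))); lra.
Qed.

End Sublinear.

(** * Banach sequence spaces *)

Section SequenceSpace.

Variables (X : CompleteNormedModule C_AbsRing) (coord : X -> nat -> C).
Hypothesis hX : banach_sequence_space X coord.

Lemma coord_zero k : coord zero k = 0%C.
Proof.
  pose proof (coord_plus hX zero zero k) as H; rewrite plus_zero_l in H.
  apply (f_equal (fun c => c - coord zero k)%C) in H; ring_simplify in H; auto.
Qed.

Lemma coord_opp x k : coord (opp x) k = (- coord x k)%C.
Proof.
  assert (H : coord zero k = (coord x k + coord (opp x) k)%C).
  { rewrite <- (coord_plus hX); apply (f_equal (fun v => coord v k)); symmetry.
    exact (plus_opp_r (G := NormedModule.AbelianGroup _ X) x). }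
  rewrite coord_zero in H.
  replace (- coord x k)%C with (0 - coord x k)%C by ring; rewrite H; ring.
Qed.

Lemma coord_minus x y k : coord (minus x y) k = (coord x k - coord y k)%C.
Proof. etransitivity; [exact (coord_plus hX x (opp y) k)|]; rewrite coord_opp; reflexivity. Qed.

Lemma norm_solid x y : (forall k, Cmod (coord x k) <= Cmod (coord y k)) -> norm x <= norm y.
Proof.
  intros H; destruct (coord_solid hX _ _ H) as (z & Hz & N).
  rewrite (coord_inj hX x z) by (intros k; symmetry; apply Hz); exact N.
Qed.

(** A choice by description, unique since [coord] is injective; meaningful only if [s] belongs to
    the space, which solidity provides in every use. *)
Definition vec (s : nat -> C) : X := iota (fun x => forall k, coord x k = s k).

Lemma coord_vec s y : (forall k, Cmod (s k) <= Cmod (coord y k)) ->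
  forall k, coord (vec s) k = s k.
Proof.
  intros H; apply (iota_correct (fun x => forall k, coord x k = s k)).
  destruct (coord_solid hX _ _ H) as (x & Hx & _); exists x; split; [exact Hx|].
  intros x' Hx'; apply (coord_inj hX); intros k; rewrite Hx, Hx'; reflexivity.
Qed.

Lemma norm_sublinear : sublinear X norm.
Proof.
  split; [exact norm_triangle|]; intros t x Ht; rewrite norm_scal_C, Cmod_R, Rabs_pos_eq; lra.
Qed.

(** If some [x] has [x_j <> 0], solidity puts [x_j e_j] in the space, and its multiple by
    [z_j / x_j] is dominated by [z]. Otherwise the coordinate vanishes identically and [B = 0]
    works. *)
Lemma coord_bounded j : exists B, 0 <= B /\ forall z, Cmod (coord z j) <= B * norm z.
Proof.
  destruct (classic (exists x, coord x j <> 0%C)) as [[x Hx]|H].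
  - set (s := fun k => if Nat.eqb k j then coord x k else 0%C).
    assert (Hs : forall k, coord (vec s) k = s k).
    { apply (coord_vec s x); intros k; unfold s; destruct (Nat.eqb k j); [lra|].
      rewrite Cmod_0; apply Cmod_ge_0. }
    assert (Pe : 0 < norm (vec s)).
    { apply (norm_pos X); intros E; apply Hx.
      assert (K : coord (vec s) j = 0%C) by (rewrite E; apply coord_zero).
      rewrite Hs in K; unfold s in K; rewrite Nat.eqb_refl in K; exact K. }
    assert (Px : 0 < Cmod (coord x j)) by (apply Cmod_gt_0; exact Hx).
    exists (Cmod (coord x j) / norm (vec s)); split; [apply Rlt_le, Rdiv_lt_0_compat; lra|].
    intros z.
    assert (N : norm (scal (coord z j / coord x j)%C (vec s)) <= norm z).
    { apply norm_solid; intros k; rewrite (coord_scal hX), Hs; unfold s.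
      destruct (Nat.eqb_spec k j) as [->|]; [|rewrite Cmult_0_r, Cmod_0; apply Cmod_ge_0].
      right; f_equal; field; exact Hx. }
    rewrite norm_scal_C, Cmod_div in N by exact Hx.
    apply (Rmult_le_compat_r (Cmod (coord x j) / norm (vec s))) in N.
    2:{ apply Rlt_le, Rdiv_lt_0_compat; lra. }
    rewrite (Rmult_comm _ (norm z)).
    eapply Rle_trans; [|exact N]; right; field; split; lra.
  - exists 0; split; [lra|]; intros z; rewrite Rmult_0_l.
    destruct (Ceq_dec (coord z j) 0) as [->|E]; [rewrite Cmod_0; lra|].
    exfalso; apply H; exists z; exact E.
Qed.

(** * Norming weights of a finitely supported unit vector *)

Section FinitelySupported.

Variables (p : X) (n : nat).
Hypothesis p_support : forall k, (n < k)%nat -> coord p k = 0%C.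

(** The vector [p_j e_j], in the space by solidity whether or not [e_j] is. *)
Definition atom (j : nat) : X := vec (fun k => if Nat.eqb k j then coord p k else 0%C).

Lemma coord_atom j k : coord (atom j) k = if Nat.eqb k j then coord p k else 0%C.
Proof.
  apply (coord_vec (fun k => if Nat.eqb k j then coord p k else 0%C) p); intros i.
  destruct (Nat.eqb i j); [lra | rewrite Cmod_0; apply Cmod_ge_0].
Qed.

Definition comb (c : nat -> C) : X := sum_n (fun j => scal (c j) (atom j)) n.

Lemma coord_comb c k : coord (comb c) k = (c k * coord p k)%C.
Proof.
  assert (H : forall m, coord (sum_n (fun j => scal (c j) (atom j)) m) k
    = if Nat.leb k m then (c k * coord p k)%C else 0%C).
  { induction m as [|m IH].
    - rewrite sum_O, (coord_scal hX), coord_atom.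
      destruct k; simpl; [reflexivity | ring].
    - rewrite sum_Sn, (coord_plus hX), IH, (coord_scal hX), coord_atom.
      destruct (Nat.eqb_spec k (S m)) as [->|Hk].
      + destruct (Nat.leb_spec (S m) m); [lia|]; rewrite Nat.leb_refl; ring.
      + destruct (Nat.leb_spec k m), (Nat.leb_spec k (S m)); try lia; ring. }
  unfold comb; rewrite H.
  destruct (Nat.leb_spec k n); [reflexivity|]; rewrite p_support by lia; ring.
Qed.

Lemma comb_1 : comb (fun _ => 1%C) = p.
Proof. apply (coord_inj hX); intros k; rewrite coord_comb; ring. Qed.

Lemma sum_atoms : sum_n atom n = p.
Proof.
  rewrite <- comb_1; unfold comb; apply sum_n_ext; intros j; symmetry.
  exact (scal_one (V := X) (atom j)).
Qed.

Lemma norm_comb_le c : norm (comb c) <= sum_n (fun j => Cmod (c j) * norm (atom j)) n.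
Proof.
  eapply Rle_trans; [apply (sublinear_sum_le X norm _ n norm_sublinear)|].
  right; apply sum_n_ext; intros j; apply norm_scal_C.
Qed.

Hypothesis p_unit : norm p = 1.
Hypothesis X_c_convex : strictly_c_convex X.

(** If [p - p_j e_j] had norm 1, it would not be complex extreme: adding [zeta p_j e_j] with
    [|zeta| <= 1] gives vectors dominated by [p], hence in the ball. *)
Lemma norm_minus_atom_lt j : coord p j <> 0%C -> norm (minus p (atom j)) < 1.
Proof.
  intros Hj.
  assert (L : norm (minus p (atom j)) <= 1).
  { rewrite <- p_unit; apply norm_solid; intros k; rewrite coord_minus, coord_atom.
    destruct (Nat.eqb k j); [|right; f_equal; ring].
    replace (coord p k - coord p k)%C with (RtoC 0) by ring; rewrite Cmod_0; apply Cmod_ge_0. }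
  destruct L as [L|L]; [exact L|exfalso].
  destruct (X_c_convex _ L) as [_ H].
  destruct (H (atom j)) as (z & Hz & K).
  { intros E; apply Hj; assert (K : coord (atom j) j = 0%C) by (rewrite E; apply coord_zero).
    rewrite coord_atom, Nat.eqb_refl in K; exact K. }
  apply K; unfold unit_ball; rewrite <- p_unit; apply norm_solid; intros k.
  rewrite (coord_plus hX), (coord_scal hX), coord_minus, coord_atom.
  destruct (Nat.eqb k j).
  - replace (coord p k - coord p k + z * coord p k)%C with (z * coord p k)%C by ring.
    rewrite Cmod_mult; pose proof (Cmod_ge_0 (coord p k)); nra.
  - right; f_equal; ring.
Qed.

(** Where [p] vanishes the value is arbitrary, and is only used multiplied by something that
    vanishes there too. *)
Definition ratio (z : X) (j : nat) : C := (coord z j / coord p j)%C.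

Lemma ratio_spec z j : (ratio z j * coord p j)%C = coord z j \/ coord p j = 0%C.
Proof.
  destruct (Ceq_dec (coord p j) 0) as [E|E]; [right; exact E | left].
  unfold ratio; field; exact E.
Qed.

(* [b j] is the value at [atom j] of a functional norming [p]; so [p] corresponds to
   ratios 1 and the functional reads [z |-> sum b_j * ratio z j]. *)
Lemma norming_weights : exists b : nat -> R,
  sum_n b n = 1 /\
  (forall j, (j <= n)%nat -> coord p j <> 0%C -> 0 < b j) /\
  (forall j, coord p j = 0%C -> b j = 0) /\
  (forall z, sum_n (fun j => b j * Cmod (ratio z j)) n <= norm z).
Proof.
  destruct (sublinear_support X norm p atom n norm_sublinear) as (q & Q & L & P & N).
  rewrite p_unit in P.
  (* [1 <= q p <= q (atom j) + q (p - atom j)], and the last term is below 1. *)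
  assert (Pos : forall j, (j <= n)%nat -> coord p j <> 0%C -> 0 < q (atom j)).
  { intros j _ Hj; pose proof (norm_minus_atom_lt j Hj) as H.
    assert (H1 : q p <= q (atom j) + q (minus p (atom j))).
    { eapply Rle_trans; [right; apply f_equal; symmetry|apply Q].
      exact (plus_minus_cancel (NormedModule.AbelianGroup _ X) p (atom j)). }
    pose proof (L (minus p (atom j))) as H2; lra. }
  assert (Zero : forall j, coord p j = 0%C -> q (atom j) = 0).
  { intros j Hj; replace (atom j) with (@zero X); [apply (sublinear_zero X q Q)|].
    apply (coord_inj hX); intros k; rewrite coord_zero, coord_atom.
    destruct (Nat.eqb_spec k j) as [->|]; auto. }
  (* The vector with terms [|ratio z k| p_k] is dominated by [z], and on such combinations of atoms
     [q] is at least the weighted sum. *)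
  assert (Bound : forall z, sum_n (fun j => q (atom j) * Cmod (ratio z j)) n <= norm z).
  { intros z; apply Rle_trans with (q (comb (fun j => RtoC (Cmod (ratio z j))))).
    - rewrite (sum_n_ext _ (fun j => Cmod (ratio z j) * q (atom j))) by (intros; apply Rmult_comm).
      apply (sublinear_sum_ge X q atom (fun j => Cmod (ratio z j)) n Q N).
      intros j; apply Cmod_ge_0.
    - eapply Rle_trans; [apply L|]; apply norm_solid; intros k; rewrite coord_comb.
      rewrite Cmod_mult, Cmod_R, Rabs_pos_eq, <- Cmod_mult by apply Cmod_ge_0.
      destruct (ratio_spec z k) as [->| ->]; [lra|].
      rewrite Cmult_0_r, Cmod_0; apply Cmod_ge_0. }
  exists (fun j => q (atom j)); split; [|auto].
  (* [<=] is the bound at [z = p], where the ratios are 1 on the support; [>=] is subadditivity on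
     [p] as the sum of its atoms. *)
  apply Rle_antisym.
  - rewrite <- p_unit; eapply Rle_trans; [|apply (Bound p)]; right; apply sum_n_ext; intros j.
    change (q (atom j) = q (atom j) * Cmod (ratio p j)).
    destruct (Ceq_dec (coord p j) 0) as [E|E]; [rewrite (Zero j E); ring|].
    unfold ratio; replace (coord p j / coord p j)%C with (RtoC 1) by (field; exact E).
    rewrite Cmod_1; ring.
  - eapply Rle_trans; [exact P|]; rewrite <- sum_atoms at 1; apply sublinear_sum_le, Q.
Qed.

End FinitelySupported.
End SequenceSpace.

(** * Peak functions *)

Lemma sum_n_nonneg (a : nat -> R) n : (forall j, 0 <= a j) -> 0 <= sum_n a n.
Proof.
  intros H; induction n as [|n IH]; [rewrite sum_O; apply H|].
  rewrite sum_Sn; specialize (H (S n)); unfold plus; simpl; lra.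
Qed.

Lemma le_sum_n (a : nat -> R) n j : (forall j, 0 <= a j) -> (j <= n)%nat -> a j <= sum_n a n.
Proof.
  intros H Hj; induction Hj as [|n Hj IH].
  - destruct j as [|j]; [rewrite sum_O; lra|].
    rewrite sum_Sn; pose proof (sum_n_nonneg a j H); unfold plus; simpl; lra.
  - rewrite sum_Sn; specialize (H (S n)); unfold plus; simpl; lra.
Qed.

Lemma sum_n_le (a b : nat -> R) n : (forall j, a j <= b j) -> sum_n a n <= sum_n b n.
Proof. intros H; apply sum_n_m_le, H. Qed.

Lemma Re_sum_n (a : nat -> C) n : Re (sum_n (G := CK) a n) = sum_n (fun j => Re (a j)) n.
Proof.
  induction n as [|n IH]; [rewrite !sum_O; reflexivity|].
  rewrite !sum_Sn, <- IH; apply re_plus.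
Qed.

(** After cancellation the claim is [(Im s)^2 / 2 <= |s| - Re s]. It holds because
    [(Im s)^2 = (|s| - Re s) (|s| + Re s)] and [|s| + Re s <= 2]. *)
Lemma quadratic_term_bound (b : R) (s : C) : Cmod s <= 1 ->
  b - Cmod s + Cmod (s - b) ^ 2 / 4 <= Re ((s - b) * (s - b) / 4 - (s - b)).
Proof.
  intros Hs; pose proof (re_le_Cmod s) as Hx; apply Rabs_le_between in Hx.
  pose proof (Cmod2_alt s) as E; rewrite (Cmod2_alt (s - b)).
  pose proof (Cmod_ge_0 s).
  assert (F : Re ((s - b) * (s - b) / 4 - (s - b))
    = ((Re s - b) ^ 2 - Im s ^ 2) / 4 - (Re s - b)).
  { destruct s; simpl; field. }
  rewrite F; clear F.
  replace (Re (s - b)) with (Re s - b) by (destruct s; simpl; ring).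
  replace (Im (s - b)) with (Im s) by (destruct s; simpl; ring).
  nra.
Qed.

Section Peak.

Variables (X : CompleteNormedModule C_AbsRing) (coord : X -> nat -> C).
Hypothesis hX : banach_sequence_space X coord.
Variables (p : X) (n : nat).
Hypothesis p_support : forall k, (n < k)%nat -> coord p k = 0%C.
Variable b : nat -> R.
Hypothesis b_sum : sum_n b n = 1.
Hypothesis b_pos : forall j, (j <= n)%nat -> coord p j <> 0%C -> 0 < b j.
Hypothesis b_zero : forall j, coord p j = 0%C -> b j = 0.
Hypothesis b_norming :
  forall z, sum_n (fun j => b j * Cmod (ratio X coord p z j)) n <= norm z.

Local Notation ratio := (ratio X coord p).

Lemma norm_plus_le (x y : X) : norm (plus x y) <= norm x + norm y.
Proof. exact (norm_triangle x y). Qed.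

Lemma b_nonneg j : 0 <= b j.
Proof.
  destruct (Ceq_dec (coord p j) 0) as [E|E]; [rewrite (b_zero j E); lra|].
  destruct (Nat.le_gt_cases j n) as [H|H]; [apply Rlt_le, b_pos; auto|].
  destruct (E (p_support j H)).
Qed.

Lemma b_le_1 j : b j <= 1.
Proof.
  destruct (Nat.le_gt_cases j n) as [H|H].
  - rewrite <- b_sum; apply le_sum_n; [exact b_nonneg | exact H].
  - rewrite (b_zero j (p_support j H)); lra.
Qed.

Lemma weighted_ratio_le_1 z j : norm z <= 1 -> Cmod (b j * ratio z j) <= 1.
Proof.
  intros Hz; rewrite Cmod_mult, Cmod_R, Rabs_pos_eq by apply b_nonneg.
  destruct (Nat.le_gt_cases j n) as [H|H].
  - eapply Rle_trans; [|exact Hz]; eapply Rle_trans; [|apply b_norming].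
    apply (le_sum_n (fun j => b j * Cmod (ratio z j))); [|exact H].
    intros i; apply Rmult_le_pos; [apply b_nonneg | apply Cmod_ge_0].
  - rewrite (b_zero j (p_support j H)); lra.
Qed.

Definition deviation (z : X) (j : nat) : C := (b j * ratio z j - b j)%C.

(** The linear part alone has nonnegative real part on the ball, but this may vanish away from [p],
    as for an l^1 norm; the squares detect every single deviation. *)
Definition peak_gauge (z : X) : C :=
  sum_n (G := CK) (fun j => deviation z j * deviation z j / 4 - deviation z j)%C n.

(* The loss [b j - |b j * ratio z j|] sums to something nonnegative since
   [sum b j = 1 >= norm z]. *)
Lemma peak_gauge_bound z : norm z <= 1 ->
  sum_n (fun j => Cmod (deviation z j) ^ 2 / 4) n <= Re (peak_gauge z).
Proof.
  intros Hz; unfold peak_gauge; rewrite Re_sum_n.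
  set (c := fun j => b j * Cmod (ratio z j)).
  set (d := fun j => Cmod (deviation z j) ^ 2 / 4).
  apply Rle_trans with (sum_n (fun j => (b j + - c j) + d j) n).
  - assert (E : sum_n (fun j => (b j + - c j) + d j) n = (sum_n b n - sum_n c n) + sum_n d n).
    { clear; induction n as [|m IH]; apply Rminus_diag_uniq; [rewrite !sum_O; ring|].
      rewrite !sum_Sn, IH; unfold plus; simpl; ring. }
    rewrite E; pose proof (b_norming z) as N; fold c in N; lra.
  - apply sum_n_le; intros j; unfold d, c, deviation.
    pose proof (quadratic_term_bound (b j) (b j * ratio z j)%C (weighted_ratio_le_1 z j Hz)) as Q.
    rewrite (Cmod_mult (b j)), Cmod_R, (Rabs_pos_eq (b j)) in Q by apply b_nonneg; lra.
Qed.

Lemma peak_gauge_p : peak_gauge p = 0%C.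
Proof.
  assert (D : forall j, deviation p j = 0%C).
  { intros j; unfold deviation, ratio.
    destruct (Ceq_dec (coord p j) 0) as [E|E]; [rewrite (b_zero j E); ring|].
    field; exact E. }
  assert (H : forall m, sum_n (G := CK)
    (fun j => deviation p j * deviation p j / 4 - deviation p j)%C m = RtoC 0).
  { induction m as [|m IH]; [rewrite sum_O | rewrite sum_Sn, IH]; rewrite D.
    - change (@eq C (0 * 0 / 4 - 0)%C 0%C); field.
    - change (@eq C (0 + (0 * 0 / 4 - 0))%C 0%C); field. }
  apply H.
Qed.

(** * Regularity of the gauge and of the peak function *)

Lemma deviation_minus z w j :
  (deviation z j - deviation w j = b j / coord p j * (coord z j - coord w j))%C.
Proof. unfold deviation, ratio, Cdiv; ring. Qed.

Lemma peak_gauge_lipschitz : exists L, 0 <= L /\ forall z w, norm z <= 1 -> norm w <= 1 ->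
  Cmod (peak_gauge z - peak_gauge w) <= L * norm (minus z w).
Proof.
  assert (D : forall z j, norm z <= 1 -> Cmod (deviation z j) <= 2).
  { intros z j Hz; unfold deviation, Cminus.
    eapply Rle_trans; [apply Cmod_triangle|]; rewrite Cmod_opp, Cmod_R, Rabs_pos_eq by apply b_nonneg.
    pose proof (weighted_ratio_le_1 z j Hz); pose proof (b_le_1 j); lra. }
  assert (T : forall j, exists L, 0 <= L /\ forall z w, norm z <= 1 -> norm w <= 1 ->
    Cmod ((deviation z j * deviation z j / 4 - deviation z j)
      - (deviation w j * deviation w j / 4 - deviation w j)) <= L * norm (minus z w)).
  { intros j; destruct (coord_bounded X coord hX j) as (B & HB & HB').
    (* The 2 bounds the factor [(t + t') / 4 - 1] of the difference, where the deviations [t] and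
       [t'] have modulus at most 2. *)
    exists (2 * (Cmod (b j / coord p j) * B)); split.
    { repeat apply Rmult_le_pos; try lra; apply Cmod_ge_0. }
    intros z w Hz Hw.
    replace ((deviation z j * deviation z j / 4 - deviation z j)
      - (deviation w j * deviation w j / 4 - deviation w j))%C
      with (((deviation z j + deviation w j) / 4 - 1) * (deviation z j - deviation w j))%C by field.
    rewrite Cmod_mult, deviation_minus, Cmod_mult, Rmult_assoc, Rmult_assoc.
    apply Rmult_le_compat; try apply Cmod_ge_0.
    - apply Rmult_le_pos; apply Cmod_ge_0.
    - unfold Cminus; eapply Rle_trans; [apply Cmod_triangle|].
      rewrite Cmod_opp, Cmod_1, Cmod_div, Cmod_R, Rabs_pos_eq; [|lra|].
      + pose proof (Cmod_triangle (deviation z j) (deviation w j)).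
        pose proof (D z j Hz); pose proof (D w j Hw); lra.
      + intros E; apply RtoC_inj in E; lra.
    - apply Rmult_le_compat_l; [apply Cmod_ge_0|].
      rewrite <- (coord_minus X coord hX); apply HB'. }
  unfold peak_gauge; clear - T; induction n as [|m (L & HL & IH)].
  - destruct (T O) as (L & HL & K); exists L; split; [exact HL|]; intros z w Hz Hw.
    rewrite !sum_O; apply K; auto.
  - destruct (T (S m)) as (L' & HL' & K); exists (L + L'); split; [lra|]; intros z w Hz Hw.
    rewrite !sum_Sn; specialize (IH z w Hz Hw); specialize (K z w Hz Hw).
    rewrite Rmult_plus_distr_r.
    eapply Rle_trans; [|apply Rplus_le_compat; [exact IH | exact K]].
    eapply Rle_trans; [|apply Cmod_triangle]; right; f_equal.
    unfold plus; simpl; ring.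
Qed.

Lemma ex_filterdiff_coord_affine (c d : C) j (z : X) :
  ex_filterdiff (V := CK) (fun x => c * coord x j + d)%C (locally z).
Proof.
  assert (L : is_linear (V := CK) (fun x : X => c * coord x j)%C).
  { destruct (coord_bounded X coord hX j) as (B & HB & HB'); split.
    - intros x y; rewrite (coord_plus hX); apply Cmult_plus_distr_l.
    - intros k x; rewrite (coord_scal hX); change (c * (k * coord x j) = k * (c * coord x j))%C; ring.
    (* The [+ 1] makes the operator bound strictly positive, as [is_linear] demands. *)
    - exists (Cmod c * B + 1); pose proof (Cmod_ge_0 c); split; [nra|]; intros x.
      change (Cmod (c * coord x j) <= (Cmod c * B + 1) * norm x); rewrite Cmod_mult.
      pose proof (HB' x); pose proof (norm_ge_0 x).
      assert (Cmod c * Cmod (coord x j) <= Cmod c * (B * norm x)) by (apply Rmult_le_compat_l; lra).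
      lra. }
  eexists; apply (filterdiff_plus_fct (V := CK)); [apply filterdiff_linear, L|].
  apply filterdiff_const.
Qed.

Lemma ex_filterdiff_peak_gauge z : ex_filterdiff (V := CK) peak_gauge (locally z).
Proof.
  assert (T : forall j, ex_filterdiff (V := CK)
    (fun z => deviation z j * deviation z j / 4 - deviation z j)%C (locally z)).
  { intros j.
    (* [t^2 / 4 - t] is the product of [t] and [t / 4 - 1], both affine in the coordinate. *)
    destruct (ex_filterdiff_coord_affine (b j / coord p j) (- b j) j z) as [l1 H1].
    destruct (ex_filterdiff_coord_affine (b j / coord p j / 4) (- b j / 4 - 1) j z) as [l2 H2].
    eexists; eapply (filterdiff_ext (V := CK));
      [|exact (filterdiff_mult_fct _ _ _ _ _ Cmult_comm H1 H2)].
    intros y; unfold mult; simpl; unfold deviation, ratio, Cdiv; ring. }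
  unfold peak_gauge; clear - T; induction n as [|m [l IH]].
  - destruct (T O) as [l H]; exists l; eapply (filterdiff_ext (V := CK)); [|exact H].
    intros y; rewrite sum_O; reflexivity.
  - destruct (T (S m)) as [l' H]; eexists.
    eapply (filterdiff_ext (V := CK)); [|exact (filterdiff_plus_fct (V := CK) _ _ _ _ IH H)].
    intros y; rewrite sum_Sn; reflexivity.
Qed.

Definition peak (z : X) : C := (/ (1 + peak_gauge z))%C.

Lemma Cmod_peak_denominator z : norm z <= 1 ->
  1 + sum_n (fun j => Cmod (deviation z j) ^ 2 / 4) n <= Cmod (1 + peak_gauge z).
Proof.
  intros Hz; pose proof (peak_gauge_bound z Hz).
  pose proof (re_le_Cmod (1 + peak_gauge z)) as R; rewrite re_plus, re_RtoC in R.
  apply Rabs_le_between in R; lra.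
Qed.

Lemma peak_denominator_ge_1 z : norm z <= 1 -> 1 <= Cmod (1 + peak_gauge z).
Proof.
  intros Hz; eapply Rle_trans; [|apply (Cmod_peak_denominator z Hz)].
  assert (0 <= sum_n (fun j => Cmod (deviation z j) ^ 2 / 4) n); [|lra].
  apply sum_n_nonneg; intros j; pose proof (pow2_ge_0 (Cmod (deviation z j))); lra.
Qed.

Lemma peak_denominator_neq_0 z : norm z <= 1 -> (1 + peak_gauge z <> 0)%C.
Proof. intros Hz; pose proof (peak_denominator_ge_1 z Hz); apply Cmod_gt_0; lra. Qed.

Lemma Cmod_peak_le_1 z : norm z <= 1 -> Cmod (peak z) <= 1.
Proof.
  intros Hz; unfold peak; rewrite Cmod_inv by (apply peak_denominator_neq_0, Hz).
  apply Rle_trans with (/ 1); [|rewrite Rinv_1; lra].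
  apply Rinv_le_contravar; [lra | apply peak_denominator_ge_1, Hz].
Qed.

(** A difference of peak values is a difference of gauges times two peak values of modulus at most
    1, so the constant of the gauge is kept. *)
Lemma peak_lipschitz : exists L, 0 <= L /\ forall z w, norm z <= 1 -> norm w <= 1 ->
  Cmod (peak z - peak w) <= L * norm (minus z w).
Proof.
  destruct peak_gauge_lipschitz as (L & HL & K); exists L; split; [exact HL|]; intros z w Hz Hw.
  specialize (K w z Hw Hz).
  pose proof (peak_denominator_neq_0 z Hz); pose proof (peak_denominator_neq_0 w Hw).
  replace (peak z - peak w)%C with ((peak_gauge w - peak_gauge z) * (peak z * peak w))%C
    by (unfold peak; field; auto).
  rewrite !Cmod_mult.
  pose proof (Cmod_peak_le_1 z Hz); pose proof (Cmod_peak_le_1 w Hw).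
  pose proof (Cmod_ge_0 (peak z)); pose proof (Cmod_ge_0 (peak w)).
  pose proof (Cmod_ge_0 (peak_gauge w - peak_gauge z)).
  assert (Cmod (peak z) * Cmod (peak w) <= 1 * 1) by (apply Rmult_le_compat; lra).
  assert (N : norm (minus w z) = norm (minus z w)).
  { apply Rle_antisym; apply (norm_solid X coord hX); intros k;
      rewrite !(coord_minus X coord hX), <- Cmod_opp; right; f_equal; ring. }
  rewrite N in K; nra.
Qed.

Lemma peak_algebra_u : algebra_u X peak.
Proof.
  destruct peak_lipschitz as (L & HL & K).
  assert (U : forall eps, 0 < eps -> exists delta, 0 < delta /\
    forall x y, unit_ball X x -> unit_ball X y ->
      norm (minus x y) < delta -> Cmod (peak x - peak y) < eps).
  { intros eps Heps; exists (eps / (L + 1)); split; [apply Rdiv_lt_0_compat; lra|].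
    intros x y Hx Hy Hxy; eapply Rle_lt_trans; [apply K; auto|].
    apply (Rmult_lt_compat_r (L + 1)) in Hxy; [|lra].
    replace (eps / (L + 1) * (L + 1)) with eps in Hxy by (field; lra).
    pose proof (norm_ge_0 (minus x y)); lra. }
  split; [split; [|split]|exact U].
  - exists 1; exact Cmod_peak_le_1.
  - apply continuous_on_eps; intros x Hx eps Heps.
    destruct (U eps Heps) as (d & Hd & H); exists d; split; [exact Hd|]; intros y Hy Hyx.
    apply H; auto.
  - intros x Hx; apply locally_singleton in Hx.
    destruct (ex_filterdiff_peak_gauge x) as [l Hl].
    pose proof (filterdiff_plus_fct (V := CK) _ _ _ _
      (filterdiff_const (V := CK) (F := locally x) (RtoC 1)) Hl) as H1.
    pose proof (filterdiff_comp' (V := CK) (W := CK) _ Cinv x _ _ H1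
      (is_derive_Cinv _ (peak_denominator_neq_0 x Hx))) as H2.
    eexists; apply filterdiff_C_codomain; exact H2.
Qed.

(** * From small deviations to small distance, by the strong face property *)

Hypothesis p_unit : norm p = 1.
Hypothesis X_c_convex : strictly_c_convex X.
Hypothesis p_strong_face : has_strong_face X p.

(** For [y <> 0] the disc of points [p + zeta y] defining the face would contradict complex
    extremality of [p]. *)
Lemma face_trivial z : face X p z -> z = p.
Proof.
  intros (y & -> & Hy).
  destruct (classic (y = zero)) as [->|Hy0].
  { apply (coord_inj hX); intros k; rewrite (coord_plus hX), (coord_zero X coord hX); ring. }
  exfalso; destruct (X_c_convex p p_unit) as [_ H]; destruct (H y Hy0) as (zeta & Hz & K).
  apply K; unfold unit_ball.
  change (Rbar_le (norm (plus p (scal zeta y))) 1).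
  eapply Rbar_le_trans; [|exact Hy].
  apply (proj1 (Lub_Rbar_correct _)); exists zeta; auto.
Qed.

Lemma Cmod_cexpi t : Cmod (cexpi t) = 1.
Proof.
  unfold Cmod, cexpi; simpl; pose proof (sin2_cos2 t) as E; unfold Rsqr in E.
  replace (_ + _) with 1 by lra; apply sqrt_1.
Qed.

Lemma small_deviation r : 0 < r -> exists tau, 0 < tau /\ forall z, norm z <= 1 ->
  (forall j, (j <= n)%nat -> Cmod (deviation z j) < tau) -> norm (minus z p) < r.
Proof.
  intros Hr.
  destruct (p_strong_face (r / 2)) as (d & Hd & SF); [lra|].
  (* [K] converts deviations into norm: on the support of [p], [ratio z j - 1] is the deviation
     divided by [b j]. *)
  set (K := sum_n (fun j => Rabs (/ b j) * norm (atom X coord p j)) n).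
  assert (HK : 0 <= K).
  { apply sum_n_nonneg; intros j; apply Rmult_le_pos; [apply Rabs_pos | apply norm_ge_0]. }
  (* [m <= d] will contradict the strong face bound [1 + d], and [m <= r / 2] pays for the distance
     from [p] to [W]. *)
  set (m := Rmin d (r / 2)); assert (Hm : 0 < m) by (apply Rmin_pos; lra).
  exists (m / (K + 1)); split; [apply Rdiv_lt_0_compat; lra|]; intros z Hz Ht.
  set (tau := m / (K + 1)) in *.
  assert (Htau : 0 < tau) by (apply Rdiv_lt_0_compat; lra).
  assert (HKm : tau * K < m).
  { replace m with (tau * (K + 1)) by (unfold tau; field; lra); nra. }
  assert (Hmd : m <= d) by apply Rmin_l.
  assert (Hmr : m <= r / 2) by apply Rmin_r.
  (* [W] is the part of [z] on the support of [p], and [y] below is the rest. *)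
  set (W := comb X coord p n (ratio z)).
  assert (CW : forall k, coord W k = (ratio z k * coord p k)%C) by (intros k; apply coord_comb; auto).
  assert (NW : norm (minus p W) <= tau * K).
  { apply Rle_trans with (norm (comb X coord p n (fun j => ratio z j - 1)%C)).
    { apply (norm_solid X coord hX); intros k.
      rewrite (coord_minus X coord hX), CW, coord_comb by auto.
      rewrite <- Cmod_opp; right; f_equal; ring. }
    eapply Rle_trans; [apply norm_comb_le; auto|].
    apply Rle_trans with (sum_n (fun j => mult tau (Rabs (/ b j) * norm (atom X coord p j))) n).
    2:{ right; exact (sum_n_mult_l (K := R_Ring) tau _ n). }
    apply sum_n_le; intros j; unfold mult; simpl; rewrite <- Rmult_assoc.
    destruct (Ceq_dec (coord p j) 0) as [E|E].
    - replace (norm (atom X coord p j)) with 0; [lra|].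
      symmetry; rewrite <- (norm_zero (V := X)); f_equal; apply (coord_inj hX); intros k.
      rewrite (coord_zero X coord hX), (coord_atom X coord hX).
      destruct (Nat.eqb_spec k j) as [->|]; auto.
    - apply Rmult_le_compat_r; [apply norm_ge_0|].
      destruct (Nat.le_gt_cases j n) as [Hj|Hj]; [|destruct (E (p_support j Hj))].
      pose proof (b_pos j Hj E) as Pb; specialize (Ht j Hj).
      rewrite Rabs_pos_eq by (apply Rlt_le, Rinv_0_lt_compat, Pb).
      unfold deviation in Ht.
      replace (b j * ratio z j - b j)%C with (b j * (ratio z j - 1))%C in Ht by ring.
      rewrite Cmod_mult, Cmod_R, Rabs_pos_eq in Ht by lra.
      apply Rmult_le_reg_l with (b j); [exact Pb|].
      replace (b j * (tau * / b j)) with tau by (field; lra); lra. }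
  set (y := minus z W).
  (* Since [W] and [y] have disjoint supports, [W + zeta y] is dominated by [z]; replacing [W] by
     [p] costs at most [tau * K]. *)
  assert (NY : forall zeta : C, Cmod zeta <= 1 -> norm (plus p (scal zeta y)) <= 1 + tau * K).
  { intros zeta Hzeta.
    apply Rle_trans with (norm (plus (plus W (scal zeta y)) (minus p W))).
    { apply (norm_solid X coord hX); intros k; right; f_equal.
      rewrite !(coord_plus hX), (coord_minus X coord hX); ring. }
    eapply Rle_trans; [apply norm_plus_le|]; apply Rplus_le_compat; [|exact NW].
    eapply Rle_trans; [|exact Hz]; apply (norm_solid X coord hX); intros k.
    rewrite (coord_plus hX), (coord_scal hX); unfold y; rewrite (coord_minus X coord hX), CW.
    destruct (ratio_spec X coord p z k) as [E|E].
    - rewrite E; right; f_equal; ring.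
    - rewrite E.
      replace (ratio z k * 0 + zeta * (coord z k - ratio z k * 0))%C with (zeta * coord z k)%C by ring.
      rewrite Cmod_mult; pose proof (Cmod_ge_0 (coord z k)); nra. }
  assert (Hy : norm y < r / 2).
  { apply Rnot_le_lt; intros Hy.
    (* The test point [p - y] has difference [y] from [p], and its distance to the face, which
       reduces to [p], is at least [norm y]. *)
    specialize (SF (minus p y)).
    assert (Ey : minus p (minus p y) = y).
    { apply (coord_inj hX); intros k; rewrite !(coord_minus X coord hX); ring. }
    assert (D : Rbar_le (r / 2) (dist_to X (face X p) (minus p y))).
    { apply (proj2 (Glb_Rbar_correct _)); intros s (w & Hw & ->).
      apply face_trivial in Hw; subst w.
      apply (Rle_trans _ _ _ Hy); right; symmetry; exact (f_equal norm Ey). }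
    specialize (SF D).
    assert (U : Rbar_le (1 + d) (1 + tau * K)); [|simpl in U; lra].
    eapply Rbar_le_trans; [exact SF|].
    apply (proj2 (Lub_Rbar_correct _)); intros s (t & _ & ->).
    eapply Rle_trans; [right; exact (f_equal (fun v => norm (plus p (scal (cexpi t) v))) Ey)|].
    apply NY; rewrite Cmod_cexpi; lra. }
  apply Rle_lt_trans with (norm (plus y (opp (minus p W)))).
  { right; f_equal; apply (coord_inj hX); intros k.
    rewrite (coord_plus hX), (coord_opp X coord hX); unfold y; rewrite !(coord_minus X coord hX); ring. }
  eapply Rle_lt_trans; [apply norm_plus_le|].
  pose proof (norm_opp (minus p W)) as NO.
  apply Rle_lt_trans with (norm y + norm (minus p W)); [|lra].
  right; apply f_equal; exact NO.
Qed.

(** Away from [p] some deviation is at least [tau], and it alone adds [tau ^ 2 / 4] to the lower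
    bound 1 on the denominator. *)
Lemma peak_away r : 0 < r -> exists rho, rho < 1 /\
  forall z, norm z <= 1 -> r <= norm (minus z p) -> Cmod (peak z) <= rho.
Proof.
  intros Hr; destruct (small_deviation r Hr) as (tau & Htau & H).
  assert (P : 0 < tau ^ 2 / 4) by nra.
  exists (/ (1 + tau ^ 2 / 4)); split.
  { apply Rlt_le_trans with (/ 1); [|rewrite Rinv_1; lra].
    apply Rinv_lt_contravar; lra. }
  intros z Hz Hzp.
  destruct (classic (exists j, (j <= n)%nat /\ tau <= Cmod (deviation z j))) as [(j & Hj & Hd)|N].
  - unfold peak; rewrite Cmod_inv by (apply peak_denominator_neq_0, Hz).
    apply Rinv_le_contravar; [lra|].
    eapply Rle_trans; [|apply (Cmod_peak_denominator z Hz)]; apply Rplus_le_compat_l.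
    apply Rle_trans with (Cmod (deviation z j) ^ 2 / 4); [nra|].
    apply (le_sum_n (fun j => Cmod (deviation z j) ^ 2 / 4)); [|exact Hj].
    intros i; pose proof (pow2_ge_0 (Cmod (deviation z i))); lra.
  - exfalso; apply (Rlt_not_le _ _ (H z Hz (fun j Hj => Rnot_le_lt _ _
      (fun K => N (ex_intro _ j (conj Hj K))))) Hzp).
Qed.

Lemma peak_p : peak p = 1%C.
Proof. unfold peak; rewrite peak_gauge_p; field; intros E; apply RtoC_inj in E; lra. Qed.

End Peak.

(** * The Shilov boundary *)

Section Main.

Variables (X : CompleteNormedModule C_AbsRing) (coord : X -> nat -> C).
Hypothesis hX : banach_sequence_space X coord.

(** * Density of finitely supported vectors in the sphere *)

Definition truncation (s : nat -> C) (n k : nat) : C := if Nat.leb k n then s k else 0%C.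

Lemma Cmod_truncation s n k : Cmod (truncation s n k) <= Cmod (s k).
Proof.
  unfold truncation; destruct (Nat.leb k n); [lra | rewrite Cmod_0; apply Cmod_ge_0].
Qed.

Hypothesis hoc : order_continuous X coord.

(** Order continuity speaks of positive increasing sequences, so it is applied to the truncations of
    [|x|]; the tails of [x] and [|x|] have equal moduli, and solidity transfers the estimate. *)
Lemma truncation_converges (x : X) eps : 0 < eps -> exists p n,
  (forall k, (n < k)%nat -> coord p k = 0%C) /\ norm (minus x p) < eps.
Proof.
  intros Heps; set (s := fun k => RtoC (Cmod (coord x k))).
  assert (Ms : forall k, Cmod (s k) = Cmod (coord x k)).
  { intros k; unfold s; rewrite Cmod_R, Rabs_pos_eq by apply Cmod_ge_0; reflexivity. }
  set (a := vec X coord s).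
  assert (Ca : forall k, coord a k = s k).
  { apply (coord_vec X coord hX s x); intros k; rewrite Ms; lra. }
  set (u := fun n => vec X coord (truncation s n)).
  assert (Cu : forall n k, coord (u n) k = truncation s n k).
  { intros n; apply (coord_vec X coord hX _ a); intros k; rewrite Ca; apply Cmod_truncation. }
  assert (Pos : forall c : R, 0 <= c -> 0 <= Re (RtoC c) /\ Im (RtoC c) = 0).
  { intros c Hc; simpl; lra. }
  destruct (hoc u a) as [l Hl].
  - intros k; rewrite Ca; apply Pos, Cmod_ge_0.
  - intros k; rewrite Cu; unfold truncation.
    destruct (Nat.leb k 0); apply Pos; [apply Cmod_ge_0 | lra].
  - intros n k; rewrite (coord_minus X coord hX), !Cu; unfold truncation.
    destruct (Nat.leb_spec k (S n)), (Nat.leb_spec k n); try lia; unfold s;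
      rewrite <- RtoC_minus; apply Pos; rewrite ?Rminus_diag, ?Rminus_0_r; try apply Cmod_ge_0; lra.
  - intros n k; rewrite (coord_minus X coord hX), Ca, Cu; unfold truncation.
    destruct (Nat.leb k n); unfold s; rewrite <- RtoC_minus; apply Pos;
      rewrite ?Rminus_diag, ?Rminus_0_r; try apply Cmod_ge_0; lra.
  - assert (Lim : forall e, 0 < e -> exists N, forall n, (N <= n)%nat -> norm (minus (u n) l) < e).
    { intros e He; apply (Hl (fun v => norm (minus v l) < e)).
      apply locally_iff_norm; exists e; auto. }
    assert (E : l = a).
    { apply (coord_inj hX); intros k; rewrite Ca.
      destruct (coord_bounded X coord hX k) as (B & HB & HB').
      apply NNPP; intros Hne.
      assert (P : 0 < Cmod (s k - coord l k)).
      { apply Cmod_gt_0; intros E; apply Hne.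
        apply (f_equal (fun c => c + coord l k)%C) in E; ring_simplify in E; auto. }
      destruct (Lim (Cmod (s k - coord l k) / (B + 1))) as [N HN].
      { apply Rdiv_lt_0_compat; lra. }
      (* From index [k] on, the truncation already has its final term [s k] in position [k]. *)
      specialize (HN (max N k) (Nat.le_max_l _ _)).
      pose proof (HB' (minus (u (max N k)) l)) as H.
      rewrite (coord_minus X coord hX), Cu in H; unfold truncation in H.
      rewrite (proj2 (Nat.leb_le _ _) (Nat.le_max_r N k)) in H.
      apply (Rmult_lt_compat_r (B + 1)) in HN; [|lra].
      replace (Cmod (s k - coord l k) / (B + 1) * (B + 1)) with (Cmod (s k - coord l k)) in HN
        by (field; lra).
      pose proof (norm_ge_0 (minus (u (max N k)) l)); lra. }
    subst l; destruct (Lim eps Heps) as [N HN]; specialize (HN N (le_n N)).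
    assert (Cp : forall k, coord (vec X coord (truncation (coord x) N)) k = truncation (coord x) N k).
    { apply (coord_vec X coord hX _ x); intros k; apply Cmod_truncation. }
    exists (vec X coord (truncation (coord x) N)), N; split.
    + intros k Hk; rewrite Cp; unfold truncation; destruct (Nat.leb_spec k N); [lia | reflexivity].
    + eapply Rle_lt_trans; [|exact HN]; apply (norm_solid X coord hX); intros k.
      rewrite !(coord_minus X coord hX), Cp, Cu, Ca; unfold truncation.
      destruct (Nat.leb k N).
      * replace (coord x k - coord x k)%C with (RtoC 0) by ring; rewrite Cmod_0; apply Cmod_ge_0.
      * replace (coord x k - 0)%C with (coord x k) by ring.
        replace (0 - s k)%C with (- s k)%C by ring; rewrite Cmod_opp, Ms; lra.
Qed.

Lemma finitely_supported_dense (x : X) eps : norm x = 1 -> 0 < eps -> exists p n,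
  norm p = 1 /\ (forall k, (n < k)%nat -> coord p k = 0%C) /\ norm (minus x p) < eps.
Proof.
  (* [e <= 1 / 2] keeps the truncation away from 0, so that it can be normalised. Rescaling moves it
     by [|norm p - 1| < e], hence the half of [eps]. *)
  intros Hx Heps; set (e := Rmin (eps / 2) (1 / 2)).
  assert (He : 0 < e) by (apply Rmin_pos; lra).
  assert (He1 : e <= eps / 2) by apply Rmin_l.
  assert (He2 : e <= 1 / 2) by apply Rmin_r.
  destruct (truncation_converges x e He) as (p & n & Hp & Hxp).
  pose proof (norm_le_add_minus X x p) as N1.
  assert (Hpx : norm (minus p x) = norm (minus x p)).
  { apply Rle_antisym; apply (norm_solid X coord hX); intros k;
      rewrite !(coord_minus X coord hX), <- Cmod_opp; right; f_equal; ring. }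
  pose proof (norm_le_add_minus X p x) as N2.
  assert (N1' : norm x <= norm p + norm (minus x p)) by exact N1.
  assert (N2' : norm p <= norm x + norm (minus p x)) by exact N2.
  set (m := norm p) in *; assert (Hm : 0 < m) by lra.
  exists (scal (RtoC (/ m)) p), n; split; [|split].
  - rewrite norm_scal_C, Cmod_R, Rabs_pos_eq by (apply Rlt_le, Rinv_0_lt_compat, Hm).
    change (/ m * m = 1); apply Rinv_l; lra.
  - intros k Hk; rewrite (coord_scal hX), (Hp k Hk); ring.
  - apply Rle_lt_trans with (norm (plus (minus x p) (scal (RtoC (1 - / m)) p))).
    { apply (norm_solid X coord hX); intros k; right; f_equal.
      rewrite (coord_plus hX), !(coord_minus X coord hX), !(coord_scal hX), RtoC_minus; ring. }
    eapply Rle_lt_trans; [apply (norm_plus_le X)|].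
    rewrite norm_scal_C, Cmod_R; change (norm (minus x p) + Rabs (1 - / m) * m < eps).
    replace (Rabs (1 - / m) * m) with (Rabs (m - 1)).
    + assert (Rabs (m - 1) <= norm (minus x p)) by (apply Rabs_le; lra); lra.
    + rewrite <- (Rabs_pos_eq m) at 3 by lra; rewrite <- Rabs_mult; f_equal; field; lra.
Qed.

Hypothesis hlc : locally_c_convex X.

(** If [F] missed the ball of radius [d] around [x], the peak function of some [p] within [d / 2] of
    [x] would be at most [rho < 1] on [F], although it equals 1 at [p]. *)
Lemma unit_sphere_in_closed_boundary (F : X -> Prop) :
  closed F -> boundary X (algebra_u X) F -> forall x, norm x = 1 -> F x.
Proof.
  intros Fc [Fb Fs] x Hx; apply Fc; intros HL; apply locally_iff_norm in HL as (d & Hd & HL).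
  destruct hlc as [Hc Hf].
  destruct (finitely_supported_dense x (d / 2) Hx) as (p & n & Hp & Sp & Hxp); [lra|].
  destruct (norming_weights X coord hX p n Sp Hp Hc) as (b & b1 & b2 & b3 & b4).
  destruct (peak_away X coord hX p n Sp b b1 b2 b3 b4 Hp Hc (Hf p Hp) (d / 2)) as (rho & Hrho & K);
    [lra|].
  pose proof (Fs _ (peak_algebra_u X coord hX p n Sp b b1 b2 b3 b4)) as E.
  assert (U : Rbar_le 1 rho); [|simpl in U; lra].
  eapply Rbar_le_trans with (sup_mod X F (peak X coord p n b)).
  - rewrite <- E.
    replace (Finite 1) with (Finite (Cmod (peak X coord p n b p))).
    + apply sup_mod_ub; right; exact Hp.
    + f_equal; rewrite peak_p by auto; apply Cmod_1.
  - apply sup_mod_least; intros z Fz; apply K; [apply Fb, Fz|].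
    apply Rnot_lt_le; intros Hz; apply (HL z); [|exact Fz].
    apply Rle_lt_trans with (norm (minus z p) + norm (minus x p)).
    2:{ replace d with (d / 2 + d / 2) by field; apply Rplus_lt_compat; [exact Hz | exact Hxp]. }
    apply Rle_trans with (norm (plus (minus z p) (opp (minus x p)))).
    { apply (norm_solid X coord hX); intros k; right; f_equal.
      rewrite (coord_plus hX), (coord_opp X coord hX), !(coord_minus X coord hX); ring. }
    eapply Rle_trans; [apply (norm_plus_le X)|]; apply Rplus_le_compat_l.
    right; exact (norm_opp (minus x p)).
Qed.

End Main.

Lemma closed_unit_sphere (X : NormedModule C_AbsRing) : closed (unit_sphere X).
Proof.
  intros x H; unfold unit_sphere; apply NNPP; intros Hx; apply H.
  assert (P : 0 < Rabs (norm x - 1)) by (apply Rabs_pos_lt; lra).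
  apply locally_iff_norm; exists (Rabs (norm x - 1)); split; [exact P|]; intros y Hy E.
  pose proof (norm_le_add_minus X y x) as N1; pose proof (norm_le_add_minus X x y) as N2.
  assert (N : norm (minus x y) = norm (minus y x)).
  { rewrite <- norm_opp; f_equal; apply opp_minus. }
  unfold unit_sphere in E; rewrite E in N1, N2; rewrite N in N2.
  unfold Rabs in Hy; destruct Rcase_abs; lra.
Qed.

(** [S] is itself one of the intersected sets and lies in all the others, so the intersection is
    [S]. *)
Lemma shilov_boundary_of_extremes (X : NormedModule C_AbsRing) (A : (X -> C) -> Prop) S :
  closed S -> boundary X A S ->
  (forall F, closed F -> boundary X A F -> forall x, S x -> F x) ->
  is_shilov_boundary A S.
Proof.
  intros Sc Sb H.
  assert (E : forall x, S x <-> closed_boundaries_inter X A x).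
  { intros x; split; [intros Hx F Fc Fb; exact (H F Fc Fb x Hx) | intros K; exact (K S Sc Sb)]. }
  split; [|exact E]; destruct Sb as [Sb1 Sb2]; split.
  - intros x Hx; apply Sb1, E, Hx.
  - intros f Hf; rewrite (Sb2 f Hf); apply Rbar_le_antisym; apply sup_mod_least;
      intros x Hx; apply sup_mod_ub; apply E, Hx.
Qed.

Lemma boundary_subalgebra (X : NormedModule C_AbsRing) (A B : (X -> C) -> Prop) F :
  (forall f, A f -> B f) -> boundary X B F -> boundary X A F.
Proof. intros H [F1 F2]; split; auto. Qed.

Theorem theorem3p5
  (X : CompleteNormedModule C_AbsRing) (coord : X -> nat -> C)
  (hX : banach_sequence_space X coord)
  (hne : exists x : X, x <> zero)
  (hoc : order_continuous X coord)
  (hlc : locally_c_convex X) :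
  is_shilov_boundary (algebra_u X) (unit_sphere X) /\
  is_shilov_boundary (algebra_b X) (unit_sphere X).
Proof.
  assert (Sub : forall f, algebra_u X f -> algebra_b X f) by (intros f Hf; apply Hf).
  pose proof (unit_sphere_boundary_b X hne) as Bb.
  pose proof (unit_sphere_in_closed_boundary X coord hX hoc hlc) as Sh.
  split; apply shilov_boundary_of_extremes; try apply closed_unit_sphere.
  - exact (boundary_subalgebra X _ _ _ Sub Bb).
  - exact Sh.
  - exact Bb.
  (* A boundary for the larger algebra is one for the smaller, which contains the peak functions. *)
  - intros F Fc Fb; apply Sh; [exact Fc | exact (boundary_subalgebra X _ _ _ Sub Fb)].
Qed.
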